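(* Let $\Delta_v$ be an interior cell in $\mathbb{R}^n$ around the vertex $v$ and let $r\ge 0$ be an integer. Then $$\operatorname{mos} S^r(\Delta_v) = \max\{d \ge r : S_d^r(\Delta_v) \text{ is degenerate}\},$$ where $\operatorname{mos} S^r(\Delta_v)=\max\{\rho\ge r: S^r(\Delta_v)\subset C^\rho(\Delta_v)\}$ is the maximal order of supersmoothness.
   Context: A mesh $\Delta$ in $\mathbb{R}^n$ ($n\ge 1$) is a finite set of (closed, nondegenerate) $n$-simplices such that any two distinct $T_1,T_2\in\Delta$ have intersection that is either empty or a common $k$-face, $0\le k\le n-1$. For a vertex $v$ of $\Delta$, the cell $\Delta_v$ is the set of $n$-simplices of $\Delta$ that have $v$ as a vertex, and $\Omega_v=\bigcup\{T:T\in\Delta_v\}$. The cell $\Delta_v$ is an interior cell if $v$ lies in the interior of $\Omega_v$. A spline on $\Delta_v$ is a family $\sigma=\{(U_T,f_T): T\in\Delta_v\}$ with, for each $T$, $U_T\subset\mathbb{R}^n$ open, $T\subset U_T$ and $f_T\in C^\infty(U_T)$ real-valued; $S(\Delta_v)$ is the set of all such splines. For a multi-index $\alpha$, $D^\alpha$ is the corresponding partial derivative, of order $|\alpha|$. For an integer $r\ge0$, $S^r(\Delta_v)$ is the set of $\sigma\in S(\Delta_v)$ such that $D^\alpha f_{T_1}|_F=D^\alpha f_{T_2}|_F$ for all $|\alpha|\le r$ and all $T_1,T_2\in\Delta_v$ such that $F=T_1\cap T_2$ is an $(n-1)$-face. For an integer $\rho\ge0$, $C^\rho(\Delta_v)$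 is the set of $\sigma\in S(\Delta_v)$ such that $D^\alpha f_{T_1}(v)=D^\alpha f_{T_2}(v)$ for all $|\alpha|\le\rho$ and all $T_1,T_2\in\Delta_v$. $\Pi_d$ is the space of real polynomials on $\mathbb{R}^n$ of (total) degree at most $d$. For integers $0\le r\le d$, $S_d^r(\Delta_v)=\{s\in C^r(\Omega_v): s|_T\in\Pi_d \text{ for all } T\in\Delta_v\}$, where $C^r(\Omega_v)$ denotes functions $C^r$ on the closed set $\Omega_v$ (continuous on $\Omega_v$, $C^r$ in its interior, with all partial derivatives up to order $r$ extending continuously to $\Omega_v$). Polynomials are identified with their restrictions to $\Omega_v$, so $\Pi_d\subset S^r_d(\Delta_v)$; the space $S_d^r(\Delta_v)$ is called degenerate if $S_d^r(\Delta_v)=\Pi_d$. In both maxima, $\rho$ and $d$ range over integers. *)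

(* Defs.v *)
From HB Require Import structures.
From mathcomp Require mpoly.
Import -(notations) mpoly.
From mathcomp Require Import all_boot all_order all_algebra finmap.
From mathcomp Require Import all_classical all_reals all_analysis.

Import Order.TTheory GRing.Theory Num.Theory.
Import numFieldNormedType.Exports.

Set Implicit Arguments.
Unset Strict Implicit.
Unset Printing Implicit Defensive.

Local Open Scope classical_set_scope.
Local Open Scope ring_scope.

Definition is_max (A : set nat) (m : nat) : Prop :=
  A m /\ forall k, A k -> (k <= m)%N.

Section Splines.
Context {R : realType} {n : nat}.
Local Notation V := 'rV[R]_n.

(** A simplex is represented by its set of vertices [T : {fset V}]; the
    corresponding closed subset of R^n is [hull T]. *)

Definition hull (T : {fset V}) : set V :=
  [set x | exists c : V -> R,
    [/\ forall w, w \in T -> 0 <= c w,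
        \sum_(w <- T) c w = 1
      & x = \sum_(w <- T) c w *: w]].

Definition affinely_independent (T : {fset V}) : Prop :=
  forall c : V -> R,
    \sum_(w <- T) c w = 0 -> \sum_(w <- T) c w *: w = 0 ->
    forall w, w \in T -> c w = 0.

Definition is_simplex (k : nat) (T : {fset V}) : Prop :=
  #|` T| = k.+1 /\ affinely_independent T.

Definition is_face (k : nat) (T : {fset V}) (F : set V) : Prop :=
  exists W : {fset V}, [/\ (W `<=` T)%fset, #|` W| = k.+1 & F = hull W].

Definition common_face (k : nat) (T1 T2 : {fset V}) : Prop :=
  is_face k T1 (hull T1 `&` hull T2) /\ is_face k T2 (hull T1 `&` hull T2).

Definition is_mesh (Delta : {fset {fset V}}) : Prop :=
  (forall T, T \in Delta -> is_simplex n T) /\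
  (forall T1 T2, T1 \in Delta -> T2 \in Delta -> T1 <> T2 ->
     hull T1 `&` hull T2 = set0 \/
     exists2 k, (k < n)%N & common_face k T1 T2).

Definition is_vertex (Delta : {fset {fset V}}) (v : V) : Prop :=
  exists2 T, T \in Delta & v \in T.

Definition cell (Delta : {fset {fset V}}) (v : V) : {fset {fset V}} :=
  [fset T in Delta | v \in T]%fset.

Definition Omega (K : {fset {fset V}}) : set V :=
  \bigcup_(T in [set` K]) hull T.

Definition interior_cell (Delta : {fset {fset V}}) (v : V) : Prop :=
  (Omega (cell Delta v))^° v.

(** [partials [:: i1; ...; ik] f] is the iterated partial derivative of [f]
    with respect to [x_ik] (first), ..., [x_i1] (last). *)

Definition partial (i : 'I_n) (f : V -> R) : V -> R :=
  fun x => 'D_(delta_mx ord0 i) f x.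

Definition partials (s : seq 'I_n) (f : V -> R) : V -> R :=
  foldr partial f s.

(** The derivative D^a, for a multi-index [a] of order [mpoly.mdeg a]. *)
Definition multi_partial (a : mpoly.multinom n) (f : V -> R) : V -> R :=
  partials (flatten [seq nseq (a i) i | i <- enum 'I_n])
    f.

(** Meaningful for open [U] only: [f] is total, but the derivatives at points
    of an open set do not depend on the values of [f] outside of it. *)
Definition Ck_open (k : nat) (U : set V) (f : V -> R) : Prop :=
  (forall s i x, (size s < k)%N -> U x ->
     derivable (partials s f) x (delta_mx ord0 i)) /\
  (forall s x, (size s <= k)%N -> U x -> {for x, continuous (partials s f)}).

Definition smooth_open (U : set V) (f : V -> R) : Prop :=
  forall k, Ck_open k U f.

Definition Ck_closed (k : nat) (A : set V) (f : V -> R) : Prop :=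
  [/\ {within A, continuous f},
      Ck_open k A^° f
    & forall a, (mpoly.mdeg a <= k)%N ->
        exists2 g : V -> R, {within A, continuous g} &
          forall x, A^° x -> g x = multi_partial a f x].

(** A family [(U_T, f_T)] indexed by the simplices [T] of [K]; the values of
    the family outside of [K] are irrelevant. *)
Definition spline_family := {fset V} -> set V * (V -> R).

Definition splines (K : {fset {fset V}}) : set spline_family :=
  [set sigma | forall T, T \in K ->
     [/\ open (sigma T).1, hull T `<=` (sigma T).1
       & smooth_open (sigma T).1 (sigma T).2]].

Definition smooth_splines (r : nat) (K : {fset {fset V}}) : set spline_family :=
  [set sigma | splines K sigma /\
     forall (a : mpoly.multinom n) T1 T2, (mpoly.mdeg a <= r)%N ->
       T1 \in K -> T2 \in K -> common_face n.-1 T1 T2 ->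
       forall x, (hull T1 `&` hull T2) x ->
         multi_partial a (sigma T1).2 x = multi_partial a (sigma T2).2 x].

Definition splines_at (rho : nat) (K : {fset {fset V}}) (v : V) : set spline_family :=
  [set sigma | splines K sigma /\
     forall (a : mpoly.multinom n) T1 T2, (mpoly.mdeg a <= rho)%N ->
       T1 \in K -> T2 \in K ->
       multi_partial a (sigma T1).2 v = multi_partial a (sigma T2).2 v].

Definition is_mos (r : nat) (K : {fset {fset V}}) (v : V) (m : nat) : Prop :=
  is_max [set rho | (r <= rho)%N /\ smooth_splines r K `<=` splines_at rho K v]
    m.

(** Functions whose restriction to [A] is (the restriction of) a polynomial of
    total degree at most [d]; [mpoly.msize p] is one plus the total degree of
    [p]. *)
Definition polys_on (d : nat) (A : set V) : set (V -> R) :=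
  [set s | exists2 p : mpoly.mpoly n R, (mpoly.msize p <= d.+1)%N &
     forall x, A x -> s x = mpoly.meval (x ord0) p].

(** A function on [Omega K] is represented by any of its extensions to R^n:
    membership in this space, and in [polys_on d (Omega K)], depends only on
    the restriction of the function to [Omega K]. *)
Definition poly_splines (r d : nat) (K : {fset {fset V}}) : set (V -> R) :=
  [set s | Ck_closed r (Omega K) s /\
     forall T, T \in K -> polys_on d (hull T) s].

Definition degenerate (r d : nat) (K : {fset {fset V}}) : Prop :=
  poly_splines r d K = polys_on d (Omega K).

End Splines.

(* Main.v *)
Require Import Defs.
From mathcomp Require mpoly.
Import -(notations) mpoly.
From mathcomp Require Import all_boot all_order all_algebra finmap.
From mathcomp Require Import all_classical all_reals all_analysis.
From mathcomp Require Import ring lra.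

(** For every d >= r, the space of C^r piecewise polynomials of degree d on the
    cell is degenerate if and only if every C^r spline on the cell has a single
    d-jet at v.  The two maxima are therefore maxima of the same set of
    integers; it remains to see that this set contains r and is bounded.

    If all splines have a single d-jet at v ([splines_at_degenerate]), apply
    this to the pieces of a C^r piecewise polynomial: they form a spline, since
    a derivative of order at most r extends continuously to each closed simplex
    ([derivative_trace]), and polynomials of degree at most d with the same
    d-jet at v are equal.

    Conversely ([degenerate_splines_at]), replace the functions of a spline by
    their Taylor polynomials p_T of degree d at v.  A derivative of order at
    most r of a difference of neighbours vanishes on the common facet, which is
    star-shaped about v; hence so does the same derivative of p_T - p_T'
    ([taylor_vanish_ray]).  As the simplices around an interior point are
    connected through common facets ([facet_connectivity]), the derivatives of
    all p_T containing an interior point agree there, and by moving along the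
    segment to v this extends to boundary points.  The p_T thus glue to a C^r
    function ([glue_Ck_closed]); by degeneracy it is one polynomial of degree
    at most d, whose d-jet at v is that of every function of the spline.

    The integer r belongs to the set because all simplices of the cell are
    connected through facets containing v.  The set is bounded because a
    product of (r+1)-st powers of barycentric coordinates on one simplex,
    extended by 0 to the others, is a spline with a nonzero finite jet at v
    ([supersmoothness_bounded]). *)

Import Order.TTheory GRing.Theory Num.Theory.
Import numFieldNormedType.Exports.

Set Implicit Arguments.
Unset Strict Implicit.
Unset Printing Implicit Defensive.

Local Open Scope classical_set_scope.
Local Open Scope ring_scope.

(** * Directional derivatives *)

Section DirectionalDerivatives.
Context {R : realType} {V : normedModType R}.
Implicit Types (f : V -> R) (u v x : V) (h t : R).

Lemma is_derive_line f x u t : derivable f (t *: u + x) u ->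
  is_derive t (1 : R) (fun s : R => f (s *: u + x)) ('D_u f (t *: u + x)).
Proof.
move=> df.
have E : (fun h : R => h^-1 *: (((fun s : R => f (s *: u + x)) \o shift t) (h *: (1 : R))
     - f (t *: u + x))) =
   (fun h : R => h^-1 *: ((f \o shift (t *: u + x)) (h *: u) - f (t *: u + x))).
  apply/funext => h /=; congr (_ *: (f _ - _)).
  by rewrite scalerDl addrA [h *: (1 : R)]mulr1.
by split; [rewrite /derivable E | rewrite /derive E].
Qed.

Lemma is_derive_translate f a x u : derivable f (a + x) u ->
  is_derive x u (fun y => f (a + y)) ('D_u f (a + x)).
Proof.
move=> df.
have E : (fun h : R => h^-1 *: (((fun y => f (a + y)) \o shift x) (h *: u)
     - f (a + x))) =
   (fun h : R => h^-1 *: ((f \o shift (a + x)) (h *: u) - f (a + x))).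
  by apply/funext => h /=; congr (_ *: (f _ - _)); rewrite addrCA.
by split; [rewrite /derivable E | rewrite /derive E].
Qed.

(** The increment h may have either sign: difference quotients need both. *)
Lemma mean_value_dir f x u h :
  (forall t, `|t| <= `|h| -> derivable f (t *: u + x) u) ->
  exists2 t, `|t| <= `|h| & f (h *: u + x) - f x = h * 'D_u f (t *: u + x).
Proof.
move=> df; pose g (s : R) := f (s *: u + x).
have dg t : `|t| <= `|h| -> is_derive t (1 : R) g ('D_u f (t *: u + x)).
  by move=> /df; exact: is_derive_line.
have cg (A : set R) : A `<=` [set t | `|t| <= `|h|] -> {within A, continuous g}.
  move=> sA; apply: continuous_in_subspaceT => t /set_mem /sA /= th.
  by apply: differentiable_continuous; apply/derivable1_diffP; case: (dg t th).
have g0 : g 0 = f x by rewrite /g scale0r add0r.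
have [h0|h0] := leP 0 h.
  have sub t : t \in `[0, h] -> `|t| <= `|h|.
    by rewrite in_itv /= => /andP[t0 th]; rewrite !ger0_norm.
  have [||t /sub th E] :=
    @MVT_segment R g (fun t => 'D_u f (t *: u + x)) 0 h h0 _ (cg _ _).
  - by move=> t ti; apply: dg; apply: sub; apply: subset_itv_oo_cc ti.
  - by move=> t /=; exact: sub.
  by exists t => //; rewrite -g0 -/(g h) E subr0 mulrC.
have sub t : t \in `[h, 0] -> `|t| <= `|h|.
  by rewrite in_itv /= => /andP[t0 th]; rewrite !ler0_norm ?(ltW h0)// lerN2.
have [||t /sub th E] :=
    @MVT_segment R g (fun t => 'D_u f (t *: u + x)) h 0 (ltW h0) _ (cg _ _).
- by move=> t ti; apply: dg; apply: sub; apply: subset_itv_oo_cc ti.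
- by move=> t /=; exact: sub.
exists t => //; rewrite -g0 -/(g h) -opprB E; ring.
Qed.

(** A directional derivative that exists nearby and is continuous adds to any
    other one: the step h (a u + w) is split into h w followed by (h a) u, and
    the mean value theorem turns the second part into a derivative along u at
    a point that tends to x.  Peeling off one coordinate at a time, this
    replaces the total derivative of a C^1 function. *)
Lemma is_derive_add_dir f x (a : R) u w :
  (\forall y \near x, derivable f y u) -> {for x, continuous ('D_u f)} ->
  derivable f x w ->
  is_derive x (a *: u + w) f (a * 'D_u f x + 'D_w f x).
Proof.
move=> du cu dw.
suff cv : h^-1 *: ((f \o shift x) (h *: (a *: u + w)) - f x) @[h --> 0^'] -->
    (a * 'D_u f x + 'D_w f x : R^o).
  by split; [apply/cvg_ex; eexists; exact: cv | exact: cvg_lim].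
pose A (h : R) := h^-1 * (f ((h * a) *: u + (h *: w + x)) - f (h *: w + x)).
pose B (h : R) := h^-1 *: ((f \o shift x) (h *: w) - f x).
have -> : (fun h => h^-1 *: ((f \o shift x) (h *: (a *: u + w)) - f x)) = A \+ B.
  apply/funext => h; rewrite /A /B /= -[h^-1 * _]/(h^-1 *: _) -scalerDr.
  by congr (_ *: _); rewrite scalerDr scalerA -addrA; ring.
apply: cvgD; last exact: dw.
apply/cvgrPdist_le => e e0.
pose c := `|a| + 1.
have c0 : 0 < c by rewrite /c ltr_wpDl.
have : \forall y \near x, derivable f y u /\ `|'D_u f x - 'D_u f y| <= e / c.
  by apply: filterI => //; move/cvgrPdist_le : cu; apply; rewrite divr_gt0.
move=> /nbhs_ballP[d /= d0 Hd].
pose M := `|a| * `|u| + `|w| + 1.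
have M0 : 0 < M by rewrite /M ltr_wpDl // addr_ge0 // mulr_ge0.
have Hball t h : `|t| <= `|h * a| -> `|h| < d / M -> ball x d (t *: u + (h *: w + x)).
  move=> th hd; rewrite -ball_normE /ball_ /= addrA [_ + x]addrC opprD addrA subrr add0r normrN.
  apply: le_lt_trans (ler_normD _ _) _; rewrite !normrZ.
  have: `|t| * `|u| <= `|h| * (`|a| * `|u|).
    by rewrite mulrA -normrM ler_wpM2r.
  move: hd; rewrite ltr_pdivlMr // /M => hd H.
  apply: le_lt_trans hd; rewrite !mulrDr mulr1.
  by have := normr_ge0 h; lra.
have dM : 0 < d / M by rewrite divr_gt0.
near=> h.
have hd : `|h| < d / M.
  by near: h; apply: dnbhs0_lt.
have h0 : h != 0 by near: h; exact: nbhs_dnbhs_neq.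
have [t th E] : exists2 t, `|t| <= `|h * a| &
    f ((h * a) *: u + (h *: w + x)) - f (h *: w + x) =
    (h * a) * 'D_u f (t *: u + (h *: w + x)).
  apply: mean_value_dir => t th.
  exact: (Hd _ (Hball _ _ th hd)).1.
rewrite /A E -!mulrA mulKf // -mulrBr normrM.
have [_ H] := Hd _ (Hball _ _ th hd).
apply: le_trans (ler_wpM2l (normr_ge0 _) H) _.
rewrite mulrCA ler_piMr ?(ltW e0) // ler_pdivrMr // mul1r /c.
by rewrite lerDl.
Unshelve. all: by end_near. Qed.

(** The symmetric second difference is h^2 times a mixed second derivative at
    an intermediate point: apply the mean value theorem along u to
    y |-> f (h v + y) - f y, then along v. *)
Lemma second_difference f x u v h :
  (forall s t, `|s| <= `|h| -> `|t| <= `|h| ->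
     derivable f (s *: u + (t *: v + x)) u /\
     derivable ('D_u f) (s *: u + (t *: v + x)) v) ->
  exists s t, [/\ `|s| <= `|h|, `|t| <= `|h| &
    f (h *: u + (h *: v + x)) - f (h *: u + x) - f (h *: v + x) + f x =
    h * (h * 'D_v ('D_u f) (s *: u + (t *: v + x)))].
Proof.
move=> df; have comm s t : s *: u + (t *: v + x) = t *: v + (s *: u + x).
  by rewrite addrCA.
pose phi y := f (h *: v + y) - f y.
have dphi s : `|s| <= `|h| -> is_derive (s *: u + x) u phi
    ('D_u f (h *: v + (s *: u + x)) - 'D_u f (s *: u + x)).
  move=> sh; apply: is_deriveB.
    by apply: is_derive_translate; rewrite -comm; exact: (df s h sh (lexx _)).1.
  have zh : `|0 : R| <= `|h| by rewrite normr0.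
  by apply: derivableP; have := (df s 0 sh zh).1; rewrite scale0r add0r.
have [s sh Es] : exists2 s, `|s| <= `|h| &
    phi (h *: u + x) - phi x = h * 'D_u phi (s *: u + x).
  by apply: mean_value_dir => t /dphi ds; exact: (@ex_derive _ _ _ _ _ _ _ ds).
have [t th Et] : exists2 t, `|t| <= `|h| &
    'D_u f (h *: v + (s *: u + x)) - 'D_u f (s *: u + x) =
    h * 'D_v ('D_u f) (t *: v + (s *: u + x)).
  apply: (@mean_value_dir ('D_u f) (s *: u + x) v h) => t th.
  by rewrite -comm; exact: (df s t sh th).2.
exists s, t; split => //; rewrite (comm s t) -Et.
have [_ <-] := dphi s sh; rewrite -Es /phi (comm h h); ring.
Qed.

(** Schwarz: the second difference is symmetric in u and v, hence the two mixed
    derivatives take a common value at points arbitrarily close to x. *)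
Lemma derive_comm f x u v :
  (\forall y \near x, derivable f y u) ->
  (\forall y \near x, derivable f y v) ->
  (\forall y \near x, derivable ('D_u f) y v) ->
  (\forall y \near x, derivable ('D_v f) y u) ->
  {for x, continuous ('D_v ('D_u f))} ->
  {for x, continuous ('D_u ('D_v f))} ->
  'D_v ('D_u f) x = 'D_u ('D_v f) x.
Proof.
move=> du dv duv dvu cuv cvu.
apply/eqP; rewrite -subr_eq0 -normr_le0; apply/ler_addgt0Pr => e e0.
rewrite add0r; have e2 : 0 < e / 2 by rewrite divr_gt0.
have : \forall y \near x, [/\ derivable f y u, derivable f y v,
    derivable ('D_u f) y v, derivable ('D_v f) y u &
    `|'D_v ('D_u f) x - 'D_v ('D_u f) y| <= e / 2 /\
    `|'D_u ('D_v f) x - 'D_u ('D_v f) y| <= e / 2].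
  have cuv' := (cvgrPdist_le (FF := nbhs_filter x) _ _).1 cuv _ e2.
  have cvu' := (cvgrPdist_le (FF := nbhs_filter x) _ _).1 cvu _ e2.
  apply: filter_app cuv'; apply: filter_app cvu'; apply: filter_app duv.
  apply: filter_app dvu; apply: filter_app du; apply: filter_app dv.
  apply: nearW => y H1 H2 H3 H4 H5 H6.
  by split; [exact: H2|exact: H1|exact: H4|exact: H3|split; [exact: H6|exact: H5]].
move=> /nbhs_ballP[d /= d0 Hd].
pose M := `|u| + `|v| + 1.
have M0 : 0 < M by rewrite /M ltr_wpDl // addr_ge0.
pose h := d / 2 / M.
have h0 : 0 < h by rewrite !divr_gt0.
have Hball s t : `|s| <= `|h| -> `|t| <= `|h| -> ball x d (s *: u + (t *: v + x)).
  rewrite (gtr0_norm h0) => sh th; rewrite -ball_normE /ball_ /=.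
  rewrite addrA [_ + x]addrC opprD addrA subrr add0r normrN.
  apply: le_lt_trans (ler_normD _ _) _; rewrite !normrZ.
  apply: le_lt_trans (_ : h * M < d); last first.
    by rewrite /h divfK ?gt_eqF // ltr_pdivrMr // mulr_natr mulr2n ltrDl.
  rewrite /M !mulrDr mulr1; have := ler_wpM2r (normr_ge0 u) sh.
  by have := ler_wpM2r (normr_ge0 v) th; lra.
have [|s [t [sh th E1]]] := @second_difference f x u v h.
  by move=> s t sh th; have [H1 _ H3 _ _] := Hd _ (Hball _ _ sh th); split; [exact: H1|exact: H3].
have [|t' [s' [th' sh' E2]]] := @second_difference f x v u h.
  move=> t' s' th' sh'; rewrite addrCA.
  by have [_ H2 _ H4 _] := Hd _ (Hball _ _ sh' th'); split; [exact: H2|exact: H4].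
rewrite (addrCA (t' *: v)) (addrCA (h *: v)) in E2.
have cancel_sq (a b c c' A B : R) : a - b - c + c' = h * (h * A) ->
    a - c - b + c' = h * (h * B) -> A = B.
  rewrite [a - c - b]addrAC => -> /(mulfI (lt0r_neq0 h0)).
  by move/(mulfI (lt0r_neq0 h0)).
have E := cancel_sq _ _ _ _ _ _ E1 E2.
have [_ _ _ _ [H1 _]] := Hd _ (Hball _ _ sh th).
have [_ _ _ _ [_ H2]] := Hd _ (Hball _ _ sh' th').
rewrite E in H1; apply: le_trans (ler_distD _ _ _) _.
rewrite [e]splitr; apply: lerD H1 _.
by rewrite distrC.
Qed.

End DirectionalDerivatives.

(** * Smooth functions and the order of differentiation *)

Section SmoothFunctions.
Context {R : realType} {n : nat}.
Local Notation V := 'rV[R]_n.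
Implicit Types (f g : V -> R) (U : set V) (u x : V) (i : 'I_n) (l : seq 'I_n).

Local Notation e_ i := (delta_mx ord0 i : V).

Lemma near_eq_partials U l f g x : open U -> U x ->
  (forall y, U y -> f y = g y) -> partials l f x = partials l g x.
Proof.
move=> oU Ux fg; elim: l x Ux => [|i l IH] x Ux /=; first exact: fg.
apply: near_eq_derive; near=> y; apply: IH.
by near: y; exact: open_nbhs_nbhs.
Unshelve. all: by end_near. Qed.

Lemma partials_cat l1 l2 f : partials (l1 ++ l2) f = partials l1 (partials l2 f).
Proof. exact: foldr_cat. Qed.

Lemma smooth_derivable U f l i x : smooth_open U f -> U x ->
  derivable (partials l f) x (e_ i).
Proof. by move=> /(_ (size l).+1)[H _] Ux; exact: H. Qed.

Lemma smooth_continuous U f l x : smooth_open U f -> U x ->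
  {for x, continuous (partials l f)}.
Proof. by move=> /(_ (size l))[_ H] Ux; exact: H. Qed.

Lemma smooth_partials U f l : smooth_open U f -> smooth_open U (partials l f).
Proof.
move=> sf k; split=> [s i x _ Ux|s x _ Ux]; rewrite -partials_cat.
  exact: smooth_derivable.
exact: smooth_continuous.
Qed.

Lemma smooth_subset U U' f : U' `<=` U -> smooth_open U f -> smooth_open U' f.
Proof.
move=> sU sf k; split=> [s i x _ /sU|s x _ /sU].
  exact: smooth_derivable.
exact: smooth_continuous.
Qed.

Lemma smooth_near_derivable U f l i x : open U -> smooth_open U f -> U x ->
  \forall y \near x, derivable (partials l f) y (e_ i).
Proof.
move=> oU sf Ux; have : \forall y \near x, U y by exact: open_nbhs_nbhs.
by apply: filterS => y Uy; exact: smooth_derivable sf Uy.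
Qed.

(** Induction over the coordinates of u, with [is_derive_add_dir]. *)
Lemma smooth_is_derive U f u x : open U -> smooth_open U f -> U x ->
  is_derive x u f (\sum_i u ord0 i * partial i f x).
Proof.
move=> oU sf Ux.
rewrite {1}[u]row_sum_delta.
elim: (index_enum _) => [|i s [d1 d2]].
  by rewrite !big_nil; exact: is_derive0.
rewrite !big_cons -d2; apply: is_derive_add_dir.
- exact: (@smooth_near_derivable U f [::]).
- exact: (@smooth_continuous U f [:: i]).
- exact: d1.
Qed.

Lemma partial_comm U f i j x : open U -> smooth_open U f -> U x ->
  partial i (partial j f) x = partial j (partial i f) x.
Proof.
move=> oU sf Ux; apply: derive_comm.
- exact: (@smooth_near_derivable U f [::]).
- exact: (@smooth_near_derivable U f [::]).
- exact: (@smooth_near_derivable U f [:: j]).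
- exact: (@smooth_near_derivable U f [:: i]).
- exact: (@smooth_continuous U f [:: i; j]).
- exact: (@smooth_continuous U f [:: j; i]).
Qed.

Lemma partials_perm U f l1 l2 x : open U -> smooth_open U f -> U x ->
  perm_eq l1 l2 -> partials l1 f x = partials l2 f x.
Proof.
move=> oU sf; pose M l x := partials l f x.
have swap i l y : U y -> i \in l -> M l y = M (i :: rem i l) y.
  elim: l y => [//|j l IH] y Uy; rewrite in_cons /=.
  case: eqVneq => [->//|nij /= il].
  transitivity (partials [:: j; i] (partials (rem i l) f) y).
    rewrite /M /= /partial; apply: near_eq_derive; near=> z; apply: IH => //.
    by near: z; exact: open_nbhs_nbhs.
  exact: (partial_comm _ _ oU (smooth_partials _ sf) Uy).
elim: l1 l2 x => [|i l1 IH] l2 x Ux.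
  by rewrite perm_sym => /perm_small_eq ->.
move=> p; have il2 : i \in l2 by rewrite -(perm_mem p) mem_head.
have := swap i l2 x Ux il2; rewrite /M => -> /=.
rewrite /partial; apply: near_eq_derive; near=> z; apply: IH.
  by near: z; exact: open_nbhs_nbhs.
by rewrite -(perm_cons i) (permPl p) perm_to_rem.
Unshelve. all: by end_near. Qed.

Definition seq_of_multi (a : multinom n) : seq 'I_n :=
  flatten [seq nseq (a i) i | i <- enum 'I_n].

Lemma count_seq_of_multi a (p : pred 'I_n) :
  count p (seq_of_multi a) = (\sum_i p i * a i)%N.
Proof.
rewrite count_flatten sumnE !big_map; rewrite -/(index_enum _).
by apply: eq_bigr => i _; rewrite count_nseq.
Qed.

Lemma size_seq_of_multi a : size (seq_of_multi a) = mdeg a.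
Proof.
rewrite -count_predT count_seq_of_multi mdegE.
by apply: eq_bigr => i _; rewrite mul1n.
Qed.

Lemma perm_seq_of_multi l :
  exists2 a, mdeg a = size l & perm_eq l (seq_of_multi a).
Proof.
pose a : multinom n := Multinom (mktuple (fun i => count_mem i l)).
have p : perm_eq l (seq_of_multi a).
  apply/allP => i _ /=; rewrite count_seq_of_multi (bigD1 i) //= eqxx mul1n.
  rewrite big1 ?addn0 => [|j]; last first.
    by rewrite eq_sym eqE /= eq_sym => /negbTE ->.
  by rewrite multinomE tnth_mktuple.
by exists a; rewrite // -size_seq_of_multi (perm_size p).
Qed.

Lemma multi_partialE a f : multi_partial a f = partials (seq_of_multi a) f.
Proof. by []. Qed.

(** Multi-indices see derivatives in one fixed order only; for smooth functions
    they control the iterated derivatives in every order. *)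
Lemma eq_multi_partials U U' f g l x : open U -> smooth_open U f -> U x ->
  open U' -> smooth_open U' g -> U' x ->
  (forall a, (mdeg a = size l)%N -> multi_partial a f x = multi_partial a g x) ->
  partials l f x = partials l g x.
Proof.
move=> oU sf Ux oU' sg Ux' fg; have [a al p] := perm_seq_of_multi l.
rewrite (partials_perm oU sf Ux p) (partials_perm oU' sg Ux' p).
exact: fg.
Qed.

Lemma partialsD U f g l x : open U -> smooth_open U f -> smooth_open U g ->
  U x -> partials l (f \+ g) x = partials l f x + partials l g x.
Proof.
move=> oU sf sg; elim: l x => [//|i l IH] x Ux /=.
rewrite /partial -(deriveD (@smooth_derivable U f l i x sf Ux) (@smooth_derivable U g l i x sg Ux)).
apply: near_eq_derive; near=> y; apply: IH.
by near: y; exact: open_nbhs_nbhs.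
Unshelve. all: by end_near. Qed.

Lemma partialsZ U (c : R) f l x : open U -> smooth_open U f ->
  U x -> partials l (c \*: f) x = c * partials l f x.
Proof.
move=> oU sf; elim: l x => [//|i l IH] x Ux /=.
rewrite /partial -[RHS]/(c *: _) -(deriveZ c (@smooth_derivable U f l i x sf Ux)).
apply: near_eq_derive; near=> y; apply: IH.
by near: y; exact: open_nbhs_nbhs.
Unshelve. all: by end_near. Qed.

Lemma near_eq_continuous (T S : topologicalType) (f g : T -> S) (x : T) :
  (\near x, f x = g x) -> {for x, continuous f} -> {for x, continuous g}.
Proof.
move=> fg cf; suff : g y @[y --> x] --> f x by rewrite (nbhs_singleton fg).
by apply: cvg_trans cf; exact: near_eq_cvg.
Qed.

Lemma smoothD U f g : open U -> smooth_open U f -> smooth_open U g ->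
  smooth_open U (f \+ g).
Proof.
move=> oU sf sg k.
have E l x : U x -> \near x, (partials l f + partials l g) x = partials l (f \+ g) x.
  move=> Ux; near=> y; rewrite (partialsD l oU sf sg) //.
  by near: y; exact: open_nbhs_nbhs.
split=> [l i x _ Ux|l x _ Ux].
  apply: near_eq_derivable (E l x Ux) _.
  by apply: derivableD; apply: smooth_derivable Ux.
apply: near_eq_continuous (E l x Ux) _.
by apply: continuousD; apply: smooth_continuous Ux.
Unshelve. all: by end_near. Qed.

Lemma smoothZ U (c : R) f : open U -> smooth_open U f -> smooth_open U (c \*: f).
Proof.
move=> oU sf k.
have E l x : U x -> \near x, (c \*: partials l f) x = partials l (c \*: f) x.
  move=> Ux; near=> y; rewrite (partialsZ c l oU sf) //.
  by near: y; exact: open_nbhs_nbhs.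
split=> [l i x _ Ux|l x _ Ux].
  apply: near_eq_derivable (E l x Ux) _.
  by apply: derivableZ; apply: smooth_derivable Ux.
apply: near_eq_continuous (E l x Ux) _.
by apply: continuousZr; apply: smooth_continuous Ux.
Unshelve. all: by end_near. Qed.

End SmoothFunctions.

(** * Polynomials, Taylor polynomials and rays *)

Section Polynomials.
Context {R : realType} {n : nat}.
Local Notation V := 'rV[R]_n.
Local Notation e_ i := (delta_mx ord0 i : V).
Local Notation mder := (@mderiv n R).
Implicit Types (p q : mpoly n R) (u v x : V) (i : 'I_n) (l : seq 'I_n).

Definition peval p : V -> R := fun x => meval (x ord0) p.

Lemma is_derive_coord (j : 'I_n) x u :
  is_derive x u (fun y : V => y ord0 j) (u ord0 j).
Proof.
suff cv : h^-1 *: (((fun y : V => y ord0 j) \o shift x) (h *: u) - x ord0 j)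
    @[h --> 0^'] --> (u ord0 j : R^o).
  by split; [apply/cvg_ex; eexists; exact: cv | exact: cvg_lim].
apply: cvg_near_cst; near=> h.
have h0 : h != 0 by near: h; exact: nbhs_dnbhs_neq.
by rewrite /= !mxE addrK -[LHS]/(_ * _) mulKf.
Unshelve. all: by end_near. Qed.

(** Both properties pass from constants and coordinates to sums and products. *)
Lemma peval_smooth1 p : continuous (peval p) /\
  forall x i, is_derive x (e_ i) (peval p) (peval (mderiv i p) x).
Proof.
pose Q p := continuous (peval p) /\
  forall x i, is_derive x (e_ i) (peval p) (peval (mderiv i p) x).
have QC c : Q (mpolyC n c).
  have E : peval (mpolyC n c) = cst c by apply/funext => x; exact: mevalC.
  split=> [x|x i]; rewrite E; first exact: cst_continuous.
  by rewrite mderivC /peval meval0; exact: is_derive_cst.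
have QD a b : Q a -> Q b -> Q (a + b).
  move=> [ca da] [cb db].
  have E : peval (a + b) = peval a + peval b.
    by apply/funext => x; exact: mevalD.
  split=> [x|x i]; rewrite E; first by apply: continuousD; [exact: ca|exact: cb].
  by rewrite mderivD /peval mevalD; exact: is_deriveD.
have QM a b : Q a -> Q b -> Q (a * b).
  move=> [ca da] [cb db].
  have E : peval (a * b) = peval a * peval b.
    by apply/funext => x; exact: mevalM.
  split=> [x|x i]; rewrite E; first by apply: continuousM; [exact: ca|exact: cb].
  have := is_deriveM (da x i) (db x i).
  congr is_derive; rewrite /peval mderivM mevalD !mevalM addrC.
  by congr (_ + _); exact: mulrC.
have QX j : Q (mpolyX R (mnm1 j)).
  have E : peval (mpolyX R (mnm1 j)) = fun y : V => y ord0 j.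
    by apply/funext => x; exact: mevalXU.
  split=> [x|x i]; rewrite E; first exact: coord_continuous.
  have := is_derive_coord j x (e_ i); congr is_derive.
  rewrite /peval mderivX mevalZ !mxE eqxx /= mnm1E eq_sym.
  case: eqVneq => [->|]; last by rewrite mul0r.
  rewrite mul1r [mnm_sub _ _](_ : _ = mnm0) ?mpolyX0 ?meval1 //.
  by apply/mnmP => k; rewrite mnmBE subnn mnm0E.
have QXn j k : Q (mpolyX R (mnm1 j) ^+ k).
  elim: k => [|k IH]; first by rewrite expr0; exact: QC.
  by rewrite exprS; apply: QM.
elim/mpolyind: p => [|c m p _ _ IH]; first by rewrite -mpolyC0; exact: QC.
apply: (QD _ _) => //; rewrite -mul_mpolyC; apply: (QM _ _); first exact: QC.
rewrite mpolyXE_id; apply: (big_ind Q); [exact: QC|exact: QM|].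
by move=> j _; exact: QXn.
Qed.

Lemma partials_peval p l : partials l (peval p) = peval (foldr mder p l).
Proof.
elim: l => [//|i l IH] /=; rewrite IH; apply/funext => x.
by have [_ /(_ x i) [_ E]] := peval_smooth1 (foldr mder p l); exact: E.
Qed.

Lemma smooth_peval U p : smooth_open U (peval p).
Proof.
move=> k; split=> [l i x _ _|l x _ _]; rewrite partials_peval.
  by have [_ /(_ x i) [? _]] := peval_smooth1 (foldr mder p l).
by have [+ _] := peval_smooth1 (foldr mder p l); apply.
Qed.

Lemma multi_partial_peval p (a : multinom n) :
  multi_partial a (peval p) = peval (mderivm a p).
Proof. by rewrite multi_partialE partials_peval mderivm_foldr. Qed.

Lemma foldr_mderiv_rcons l i p :
  foldr mder p (rcons l i) = foldr mder (mderiv i p) l.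
Proof. by rewrite -cats1 foldr_cat. Qed.

Lemma msize_leP p k : reflect (forall m, (k <= mdeg m)%N -> mcoeff m p = 0)
  (msize p <= k)%N.
Proof.
apply: (iffP idP) => [pk m km|H].
  by apply: memN_msupp_eq0; apply: msize_mdeg_ge; exact: leq_trans km.
rewrite msizeE; apply/bigmax_leqP_seq => m + _.
by rewrite mcoeff_msupp ltnNge; apply: contraNN => /H ->.
Qed.

Lemma msize_mderiv i p k : (msize p <= k.+1)%N -> (msize (mderiv i p) <= k)%N.
Proof.
move=> /msize_leP pk; apply/msize_leP => m km.
by rewrite mcoeff_mderiv pk ?mul0rn // mdegD mdeg1 addn1.
Qed.

Lemma msize_foldr_mderiv l p k :
  (msize p <= k + size l)%N -> (msize (foldr mder p l) <= k)%N.
Proof.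
elim: l k => [|i l IH] k /=; first by rewrite addn0.
by rewrite addnS -addSn => /IH; exact: msize_mderiv.
Qed.

(** In characteristic 0 a nonconstant monomial survives one of the [mderiv i]. *)
Lemma mderiv0_const p : (forall i, mderiv i p = 0) -> p = mpolyC n (mcoeff mnm0 p).
Proof.
move=> H; apply/mpolyP => m; rewrite mcoeffC.
have [->|] := eqVneq m mnm0; first by rewrite mulr1.
rewrite mulr0 -mdeg_eq0 mdegE sum_nat_eq0 negb_forall => /existsP[i /= mi].
have := mcoeff_mderiv i p (mnm_sub m (mnm1 i)).
rewrite H mcoeff0; have -> : mnm_add (mnm_sub m (mnm1 i)) (mnm1 i) = m.
  by apply: submK; rewrite lep1mP.
by move/esym/eqP; rewrite mulrn_eq0 /= => /eqP.
Qed.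

(** By induction on d the partial derivatives of p vanish, so p is constant. *)
Lemma jet0_poly0 d p v : (msize p <= d.+1)%N ->
  (forall l, (size l <= d)%N -> peval (foldr mder p l) v = 0) -> p = 0.
Proof.
elim: d p => [|d IH] p pd H.
  have := H [::] isT; rewrite /= (msize1_polyC pd) /peval mevalC => ->.
  by rewrite mpolyC0.
have Hp : forall i, mderiv i p = 0.
  move=> i; apply: IH => [|l ld]; first exact: msize_mderiv.
  by rewrite -foldr_mderiv_rcons; apply: H; rewrite size_rcons.
have := H [::] isT; rewrite /= (mderiv0_const Hp) /peval mevalC => ->.
by rewrite mpolyC0.
Qed.

Lemma peval0 : peval 0 = fun=> 0.
Proof. by apply/funext => x; exact: meval0. Qed.

Lemma foldr_mderiv0 l : foldr mder 0 l = 0 :> mpoly n R.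
Proof. by elim: l => [//|i l /= ->]; rewrite mderiv0. Qed.

Lemma foldr_mderivB l p q :
  foldr mder (p - q) l = foldr mder p l - foldr mder q l.
Proof. by elim: l => [//|i l /= ->]; rewrite mderivB. Qed.

Lemma pevalB p q x : peval (p - q) x = peval p x - peval q x.
Proof. exact: mevalB. Qed.

Lemma poly_eq_open U p q : open U -> U !=set0 ->
  (forall x, U x -> peval p x = peval q x) -> p = q.
Proof.
move=> oU [x Ux] pq; apply/eqP; rewrite -subr_eq0; apply/eqP.
apply: (@jet0_poly0 (msize (p - q)) _ x) => // l _.
rewrite foldr_mderivB pevalB -!partials_peval.
by rewrite (near_eq_partials l oU Ux pq) subrr.
Qed.

Lemma jet_poly_eq d p q v : (msize p <= d.+1)%N -> (msize q <= d.+1)%N ->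
  (forall a, (mdeg a <= d)%N ->
     multi_partial a (peval p) v = multi_partial a (peval q) v) -> p = q.
Proof.
move=> pd qd pq; apply/eqP; rewrite -subr_eq0; apply/eqP.
apply: (@jet0_poly0 d _ v) => [|l ld].
  by apply: leq_trans (msizeD_le _ _) _; rewrite msizeN geq_max pd.
rewrite foldr_mderivB pevalB -!partials_peval; apply/eqP; rewrite subr_eq0.
apply/eqP; apply: (@eq_multi_partials _ _ setT setT) => //; try exact: openT.
- exact: smooth_peval.
- exact: smooth_peval.
- by move=> a al; apply: pq; rewrite al.
Qed.

(** The top-degree derivatives of a polynomial of degree d are constants that
    read off its leading coefficients, so a homogeneous part of degree d
    settles the order d, and a polynomial of degree d - 1 corrects the lower
    orders; no expansion around v is needed. *)
Lemma taylor_interpolation (c : multinom n -> R) v d :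
  exists2 p, (msize p <= d.+1)%N &
    forall a, (mdeg a <= d)%N -> multi_partial a (peval p) v = c a.
Proof.
suff : exists2 p, (msize p <= d.+1)%N &
    forall a, (mdeg a <= d)%N -> peval (mderivm a p) v = c a.
  by move=> [p pd H]; exists p => // a ad; rewrite multi_partial_peval H.
have top k (b : multinom n -> R) : exists2 q : mpoly n R, (msize q <= k.+1)%N &
    forall a, (mdeg a = k)%N -> mderivm a q = mpolyC n (b a).
  pose E (m : multinom n) : R :=
    if mdeg m == k then b m / (\prod_(i < n) (m i)`!)%:R else 0.
  exists (\sum_(m : bmultinom n k.+1) (E m *: mpolyX R m)).
    apply/msize_leP => m km; rewrite raddf_sum big1 // => m' _ /=.
    rewrite mcoeffZ mcoeffX; case: eqP => [mm'|]; last by rewrite mulr0.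
    by have := bmdeg m'; rewrite mm' ltnNge km.
  move=> a ak; apply/mpolyP => m; rewrite mcoeff_mderivm mcoeffC.
  have [->|m0] := eqVneq m mnm0.
    have -> : mnm_add a mnm0 = a by apply/mnmP => i; rewrite mnmDE mnm0E addn0.
    rewrite mcoeff_mpoly ?ak // /E ak eqxx mulr1.
    have -> : (\prod_(i < n) (a i) ^_ (a i) = \prod_(i < n) (a i)`!)%N.
      by apply: eq_bigr => i _; rewrite ffactnn.
    rewrite -[LHS]mulr_natr divfK // pnatr_eq0 -lt0n.
    by apply: prodn_gt0 => i; exact: fact_gt0.
  (* for m != 0 the monomial a + m has degree above k, where there is nothing *)
  rewrite mulr0 [X in X *+ _](_ : _ = 0) ?mul0rn //.
  rewrite raddf_sum big1 // => m' _ /=.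
  rewrite mcoeffZ mcoeffX; case: eqP => [mm'|]; last by rewrite mulr0.
  have := bmdeg m'; rewrite mm' mdegD ak ltnS -[X in (_ <= X)%N]addn0.
  by rewrite leq_add2l leqn0 mdeg_eq0 (negbTE m0).
elim: d c => [|d IH] c.
  have [q q0 Hq] := top 0%N c; exists q => // a.
  by rewrite leqn0 => /eqP /Hq ->; rewrite /peval mevalC.
have [q q0 Hq] := top d.+1 c.
have [p pd Hp] := IH (fun a => c a - peval (mderivm a q) v).
exists (p + q).
  apply: leq_trans (msizeD_le _ _) _; rewrite geq_max q0 andbT.
  exact: leq_trans pd _.
move=> a; rewrite leq_eqVlt => /orP[/eqP ad|ad].
  rewrite mderivmD Hq // [mderivm a p](_ : _ = 0).
    by rewrite add0r /peval mevalC.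
  apply/mpolyP => m; rewrite mcoeff_mderivm mcoeff0.
  move/msize_leP : pd => ->; first by rewrite mul0rn.
  by rewrite mdegD ad leq_addr.
by rewrite mderivmD [LHS]mevalD -[meval _ (mderivm a p)]/(peval _ v) Hp // subrK.
Qed.

(** For s the list of all coordinates the sum is the derivative of f along u:
    this carries the hypotheses of [taylor_vanish_ray] from f to it. *)
Lemma smooth_dir U f u s : open U -> smooth_open U f ->
  smooth_open U (fun x => \sum_(i <- s) u ord0 i * partial i f x) /\
  forall l x, U x ->
    partials l (fun x => \sum_(i <- s) u ord0 i * partial i f x) x =
    \sum_(i <- s) u ord0 i * partials (rcons l i) f x.
Proof.
move=> oU sf; elim: s => [|i s [IH1 IH2]].
  have -> : (fun x => \sum_(i <- [::]) u ord0 i * partial i f x) = peval 0.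
    by apply/funext => x; rewrite big_nil peval0.
  split=> [|l x Ux]; first exact: smooth_peval.
  by rewrite partials_peval foldr_mderiv0 peval0 big_nil.
have -> : (fun x => \sum_(i <- i :: s) u ord0 i * partial i f x) =
    (u ord0 i \*: partial i f) \+ (fun x => \sum_(i <- s) u ord0 i * partial i f x).
  by apply/funext => x; rewrite big_cons.
have s1 : smooth_open U (partial i f) := smooth_partials [:: i] sf.
have s2 : smooth_open U (u ord0 i \*: partial i f) by exact: smoothZ.
split=> [|l x Ux]; first exact: smoothD.
rewrite (partialsD l oU s2 IH1) // (partialsZ _ l oU s1) // IH2 // big_cons.
by rewrite -cats1 partials_cat.
Qed.

Lemma vanish_at_apex U f v u e : open U -> smooth_open U f -> U v ->
  0 < e -> (forall t, 0 < t -> t < e -> f (t *: u + v) = 0) -> f v = 0.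
Proof.
move=> oU sf Uv e0 fe.
have c1 : f (t *: u + v) @[t --> 0^'+] --> f v.
  apply: cvg_at_right_filter.
  have cl : (t *: u + v) @[t --> (0 : R)] --> v.
    suff : (t *: u + v) @[t --> (0 : R)] --> (0 : R) *: u + v by rewrite scale0r add0r.
    by apply: cvgD; [apply: cvgZr_tmp; exact: cvg_id | exact: cvg_cst].
  exact: cvg_comp cl (@smooth_continuous _ _ U f [::] v sf Uv).
have c2 : f (t *: u + v) @[t --> 0^'+] --> (0 : R).
  apply: cvg_near_cst; near=> t; apply: fe.
    by near: t; exact: nbhs_right_gt.
  by near: t; exact: nbhs_right_lt.
exact: cvg_unique c1 c2.
Unshelve. all: by end_near. Qed.

(** Only the open ray is used: the derivative of the zero function of t is
    two-sided there. *)
Lemma derive_vanish_ray U f v u e : open U -> smooth_open U f ->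
  (forall t, 0 < t -> t < e -> U (t *: u + v) /\ f (t *: u + v) = 0) ->
  forall t, 0 < t -> t < e -> \sum_i u ord0 i * partial i f (t *: u + v) = 0.
Proof.
move=> oU sf fe t t0 te; have [Ut _] := fe t t0 te.
have [df <-] := smooth_is_derive u oU sf Ut.
have [_ <-] := is_derive_line df.
rewrite -[RHS](derive_cst (0 : R) t (1 : R)); apply: near_eq_derive.
near=> s; rewrite (fe s _ _).2 //.
  by near: s; exact: lt_nbhsr.
by near: s; exact: lt_nbhsl.
Unshelve. all: by end_near. Qed.

(** If f vanishes on a segment issued from v, its Taylor polynomial q at v
    vanishes on the whole line.  Differentiating along the direction u of the
    segment keeps both hypotheses and lowers the degree, so by induction the
    derivative of q along the line vanishes; q is then constant on the line and
    equal to q v = f v = 0.  For f polynomial and q = f this says that a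
    polynomial vanishing on a segment vanishes on its line. *)
Lemma taylor_vanish_ray U f q v u d e : open U -> smooth_open U f -> U v ->
  (msize q <= d.+1)%N ->
  (forall l, (size l <= d)%N -> partials l f v = partials l (peval q) v) ->
  0 < e -> (forall t, 0 < t -> t < e -> U (t *: u + v) /\ f (t *: u + v) = 0) ->
  forall t, peval q (t *: u + v) = 0.
Proof.
move=> oU + Uv; elim: d f q => [|d IH] f q sf qd fq e0 fe t.
all: have qv : peval q v = 0 by
  rewrite -[LHS]/(partials [::] (peval q) v) -fq //;
  apply: (vanish_at_apex oU sf Uv e0) => s s0 se; exact: (fe s s0 se).2.
  by move: qv; rewrite (msize1_polyC qd) /peval !mevalC.
pose q' : mpoly n R := \sum_i u ord0 i *: mderiv i q.
have pq' x : peval q' x = \sum_i u ord0 i * peval (mderiv i q) x.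
  by rewrite /peval raddf_sum; apply: eq_bigr => i _; exact: mevalZ.
have mq' l : foldr mder q' l = \sum_i u ord0 i *: foldr mder q (rcons l i).
  elim: l => [//|i l /= ->]; rewrite raddf_sum; apply: eq_bigr => j _.
  by rewrite /= mderivZ.
have q'0 s : peval q' (s *: u + v) = 0.
  have [sL pL] := smooth_dir u (index_enum _) oU sf.
  apply: (IH _ q' sL) => //.
  - apply/msize_leP => m dm; rewrite raddf_sum big1 // => i _ /=.
    by rewrite mcoeffZ (msize_leP _ _ (msize_mderiv i qd)) // mulr0.
  - move=> l ld; rewrite pL // partials_peval mq' /peval raddf_sum.
    apply: eq_bigr => i _ /=; rewrite mevalZ fq ?size_rcons //.
    by rewrite partials_peval.
  - move=> s0 {}s1 s2; split; first exact: (fe _ s1 s2).1.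
    exact: derive_vanish_ray fe _ s1 s2.
rewrite -qv -[X in _ = peval q X]add0r -(scale0r u).
apply: (@is_derive_0_is_cst _ (fun t => peval q (t *: u + v)) t 0) => s.
have [dq Eq] := smooth_is_derive u openT (@smooth_peval setT q) (I : setT (s *: u + v)).
have := is_derive_line dq; congr is_derive; rewrite Eq -[RHS](q'0 s) pq'.
by apply: eq_bigr => i _; rewrite -[partial i _]/(partials [:: i] _) partials_peval.
Qed.

End Polynomials.

(** * Affine functions and barycentric coordinates *)

Section AffineFunctions.
Context {R : realType} {n : nat}.
Local Notation V := 'rV[R]_n.
Implicit Types (u v w x y : V) (T W : {fset V}) (a : 'rV[R]_(1 + n)).

(** Homogeneous coordinates (1, x), in which affine functions become linear. *)
Definition homog x : 'rV[R]_(1 + n) := row_mx (const_mx 1) x.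

Definition aff a x : R := (homog x *m a^T) ord0 ord0.

Lemma sum_homog (s : seq V) (c : V -> R) :
  \sum_(w <- s) c w *: homog w =
  row_mx (const_mx (\sum_(w <- s) c w)) (\sum_(w <- s) c w *: w).
Proof.
elim: s => [|w s IH]; last first.
  rewrite !big_cons IH /homog scale_row_mx add_row_mx; congr row_mx.
  by apply/matrixP => i j; rewrite !mxE mulr1.
by rewrite !big_nil -(row_mx0 R 1 1 n); congr row_mx.
Qed.

Lemma aff_comb a (s : seq V) (c : V -> R) : \sum_(w <- s) c w = 1 ->
  aff a (\sum_(w <- s) c w *: w) = \sum_(w <- s) c w * aff a w.
Proof.
move=> c1; rewrite /aff /homog -{1}c1 -sum_homog mulmx_suml summxE.
by apply: eq_bigr => w _; rewrite -scalemxAl mxE.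
Qed.

Lemma aff_segment a x y t :
  aff a (t *: y + (1 - t) *: x) = t * aff a y + (1 - t) * aff a x.
Proof.
have E : homog (t *: y + (1 - t) *: x) = t *: homog y + (1 - t) *: homog x.
  rewrite /homog !scale_row_mx add_row_mx; congr row_mx.
  by apply/matrixP => i j; rewrite !mxE !mulr1 addrC subrK.
by rewrite /aff E mulmxDl -!scalemxAl !mxE.
Qed.

Definition aff_poly a : mpoly n R :=
  mpolyC n (a ord0 (lshift n ord0)) +
  \sum_i a ord0 (rshift 1 i) *: mpolyX R (mnm1 i).

Lemma peval_aff_poly a x : peval (aff_poly a) x = aff a x.
Proof.
rewrite /peval /aff_poly mevalD mevalC raddf_sum /aff mxE big_split_ord /=.
rewrite big_ord1 /homog row_mxEl !mxE mul1r; congr (_ + _).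
by apply: eq_bigr => i _; rewrite row_mxEr mxE mevalZ mevalXU mulrC.
Qed.

Lemma aff_poly_neq0 a : a != 0 -> aff_poly a != 0.
Proof.
apply: contra_neq => a0; apply/rowP => j; rewrite mxE.
have C0 : a ord0 (lshift n ord0) = 0.
  have := congr1 (fun p => peval p 0) a0.
  rewrite peval0 /aff_poly /peval mevalD mevalC raddf_sum big1 ?addr0 // => i _.
  by rewrite /= mevalZ mevalXU mxE mulr0.
case: (split_ordP j) => k ->; first by rewrite ord1.
have := congr1 (fun p => peval p (delta_mx ord0 k)) a0.
rewrite peval0 /aff_poly /peval mevalD mevalC C0 add0r raddf_sum (bigD1 k) //=.
rewrite big1 ?addr0 => [|i ik]; rewrite /= mevalZ mevalXU !mxE eqxx.
  by rewrite eqxx mulr1.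
by rewrite (negbTE ik) mulr0.
Qed.

Lemma aff_continuous a : continuous (aff a).
Proof.
have -> : aff a = peval (aff_poly a) by apply/funext => x; rewrite peval_aff_poly.
by have [] := peval_smooth1 (aff_poly a).
Qed.

(** At most n points give at most n linear equations on the n + 1 coefficients
    of an affine function. *)
Lemma hyperplane_through (s : seq V) : (size s <= n)%N ->
  exists2 a, a != 0 & forall w, w \in s -> aff a w = 0.
Proof.
move=> sn; pose A : 'M[R]_(1 + n, size s) := \matrix_(i, j) homog (nth 0 s j) ord0 i.
have : kermx A != 0.
  rewrite kermx_eq0 /row_free neq_ltn; apply/orP; left.
  by apply: leq_ltn_trans (rank_leq_col A) _; rewrite add1n ltnS.
move=> /rowV0Pn[a /sub_kermxP aA a0]; exists a => // w ws.
have := congr1 (fun B : 'rV[R]_(size s) => B ord0 (Ordinal (etrans (index_mem w s) ws))) aA.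
rewrite !mxE => <-; rewrite /aff mxE; apply: eq_bigr => i _.
by rewrite !mxE mulrC nth_index.
Qed.

(** Finitely many hyperplanes do not cover a nonempty open set, because a
    product of nonzero polynomials does not vanish on one. *)
Lemma generic_point (I : eqType) (s : seq I) (a : I -> 'rV[R]_(1 + n)) (U : set V) :
  open U -> U !=set0 -> (forall i, a i != 0) ->
  exists2 x, U x & forall i, i \in s -> aff (a i) x != 0.
Proof.
move=> oU U0 a0; pose p := \prod_(i <- s) aff_poly (a i).
have p0 : p != 0.
  by rewrite prodf_seq_neq0; apply/allP => i _; exact: aff_poly_neq0.
apply: contrapT => H; move/eqP : p0; apply.
apply: (poly_eq_open oU U0) => x Ux; rewrite peval0.
apply: contrapT => /eqP px; apply: H; exists x => // i si.
move: px; rewrite /p /peval rmorph_prod prodf_seq_neq0 => /allP/(_ i si) /=.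
by rewrite -[meval _ _]/(peval _ x) peval_aff_poly.
Qed.

Lemma affinely_independent_uniq T (c d : V -> R) : affinely_independent T ->
  \sum_(w <- T) c w = \sum_(w <- T) d w ->
  \sum_(w <- T) c w *: w = \sum_(w <- T) d w *: w ->
  forall w, w \in T -> c w = d w.
Proof.
move=> aT E1 E2 w wT; apply/eqP; rewrite -subr_eq0; apply/eqP.
apply: (aT (fun w => c w - d w)) => //.
  by rewrite sumrB E1 subrr.
under eq_bigr do rewrite scalerBl.
by rewrite sumrB E2 subrr.
Qed.

(** Barycentric coordinates of a nondegenerate n-simplex: affine independence
    makes the matrix with rows (1, w), w a vertex, invertible, and the
    coordinates of x are the entries of (1, x) times its inverse. *)
Lemma barycentric T : is_simplex n T -> exists a : V -> 'rV[R]_(1 + n),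
  forall x, \sum_(w <- T) aff (a w) x = 1 /\ \sum_(w <- T) aff (a w) x *: w = x.
Proof.
move=> [sT aT].
pose M : 'M[R]_(1 + n) := \matrix_(k < 1 + n) homog (nth 0 T k).
pose idx w : 'I_(1 + n) := inord (index w T).
have sumM (b : 'rV[R]_(1 + n)) : b *m M = \sum_(w <- T) b ord0 (idx w) *: homog w.
  rewrite mulmx_sum_row [RHS](big_nth 0) big_mkord sT; apply: eq_bigr => k _.
  rewrite rowK /idx index_uniq ?sT ?fset_uniq //.
  by rewrite inord_val.
have Mu : M \in unitmx.
  rewrite -row_free_unit; apply: inj_row_free => b; rewrite sumM sum_homog.
  move=> E; apply/rowP => k; rewrite mxE.
  have [E1 E2] : \sum_(w <- T) b ord0 (idx w) = 0 /\ \sum_(w <- T) b ord0 (idx w) *: w = 0.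
    move: E; rewrite -(row_mx0 R 1 1 n) => /eq_row_mx[E1 E2]; split=> //.
    by have := congr1 (fun A : 'M[R]_(1, 1) => A ord0 ord0) E1; rewrite !mxE.
  have kT : (k < size T)%N by rewrite sT.
  have := aT (fun w => b ord0 (idx w)) E1 E2 (nth 0 T k) (mem_nth 0 kT).
  by rewrite /idx index_uniq ?fset_uniq // inord_val.
exists (fun w => (col (idx w) (invmx M))^T) => x.
have E : \sum_(w <- T) aff ((col (idx w) (invmx M))^T) x *: homog w = homog x.
  rewrite -[RHS](mulmxKV Mu) sumM; apply: eq_bigr => w _; congr (_ *: _).
  rewrite /aff trmxK mxE [RHS]mxE; apply: eq_bigr => k _.
  by rewrite [col _ _ _ _]mxE.
move: E; rewrite sum_homog => /eq_row_mx[E1 E2]; split=> //.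
by have := congr1 (fun A : 'M[R]_(1, 1) => A ord0 ord0) E1; rewrite !mxE.
Qed.

End AffineFunctions.

(** * Simplices and connectivity across facets *)

Section Simplices.
Context {R : realType} {n : nat}.
Local Notation V := 'rV[R]_n.
Implicit Types (u v w x y : V) (T W : {fset V}) (K : {fset {fset V}}).

Lemma hull_aff0 (a : 'rV[R]_(1 + n)) W x :
  (forall w, w \in W -> aff a w = 0) -> hull W x -> aff a x = 0.
Proof.
move=> aW [c [_ c1 ->]]; rewrite aff_comb // big_seq big1 // => w /aW ->.
exact: mulr0.
Qed.

Lemma hull_aff_ge0 T (a : V -> 'rV[R]_(1 + n)) : is_simplex n T ->
  (forall x, \sum_(w <- T) aff (a w) x = 1 /\ \sum_(w <- T) aff (a w) x *: w = x) ->
  hull T = [set x | forall w, w \in T -> 0 <= aff (a w) x].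
Proof.
move=> [_ aT] Ha; apply/seteqP; split=> [x [c [c0 c1 cx]] w wT|x H].
  have [s1 sx] := Ha x.
  have <- : c w = aff (a w) x; last exact: c0.
  apply: (affinely_independent_uniq (d := fun w => aff (a w) x) aT) => //.
    by rewrite c1 s1.
  by rewrite -cx sx.
by exists (fun w => aff (a w) x); have [s1 sx] := Ha x.
Qed.

Lemma hull_closed T : is_simplex n T -> closed (hull T).
Proof.
move=> sT; have [a Ha] := barycentric sT; rewrite (hull_aff_ge0 sT Ha).
have -> : [set x | forall w, w \in T -> 0 <= aff (a w) x] =
    \bigcap_(w in [set` T]) (aff (a w) @^-1` [set t | 0 <= t]).
  by apply/seteqP; split=> x H w wT; exact: H.
apply: closed_bigI => w _; apply: preimage_closed; last exact: closed_ge.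
by move=> x _; exact: aff_continuous.
Qed.

(** The set C of points with positive barycentric coordinates.  Moving from any
    point of the simplex towards a point of C enters C at once, so the simplex
    lies in the closure of C. *)
Lemma hull_interior T : is_simplex n T ->
  exists2 C : set V, open C & [/\ C !=set0, C `<=` hull T &
    forall x y t, hull T x -> C y -> 0 < t -> t <= 1 -> C (t *: y + (1 - t) *: x)].
Proof.
move=> sT; have [a Ha] := barycentric sT.
have hE := hull_aff_ge0 sT Ha; have [cT aT] := sT.
exists [set x | forall w, w \in T -> 0 < aff (a w) x].
  have -> : [set x | forall w, w \in T -> 0 < aff (a w) x] =
      \bigcap_(w in [set` T]) (aff (a w) @^-1` [set t | 0 < t]).
    by apply/seteqP; split=> x H w wT; exact: H.
  rewrite bigcap_fset; elim: (enum_fset T) => [|w s IH].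
    by rewrite big_nil; exact: openT.
  rewrite big_cons; apply: openI => //; apply: open_comp; last exact: open_gt.
  by move=> x _; exact: aff_continuous.
split.
- pose c : R := (n.+1%:R)^-1; exists (\sum_(w <- T) c *: w) => w wT /=.
  have c1 : \sum_(w <- T) c = 1.
    rewrite big_const_seq count_predT iter_addr addr0 cT -mulr_natr mulVf //.
  have [s1 sx] := Ha (\sum_(w <- T) c *: w).
  have <- : c = aff (a w) (\sum_(w <- T) c *: w); last by rewrite invr_gt0 ltr0n.
  apply: (affinely_independent_uniq (c := fun=> c) (d := fun w => aff (a w) _) aT) => //.
  by rewrite c1 s1.
- by rewrite hE => x H w wT; apply: ltW; exact: H.
- rewrite hE => x y t Hx Hy t0 t1 w wT; rewrite aff_segment ltr_pwDl //.
    by rewrite mulr_gt0 // Hy.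
  by rewrite mulr_ge0 ?Hx // subr_ge0.
Qed.

Lemma hull_vertex T v : v \in T -> hull T v.
Proof.
move=> vT; exists (fun w => (w == v)%:R); split=> [w _| |]; first exact: ler0n.
  rewrite (big_fsetD1 v) //= eqxx big_seq big1 ?addr0 // => w.
  by rewrite !inE => /andP[/negbTE ->].
rewrite (big_fsetD1 v) //= eqxx scale1r big_seq big1 ?addr0 // => w.
by rewrite !inE => /andP[/negbTE -> _]; rewrite scale0r.
Qed.

Lemma hull_convex T x y t : hull T x -> hull T y -> 0 <= t -> t <= 1 ->
  hull T (t *: y + (1 - t) *: x).
Proof.
move=> [c [c0 c1 ->]] [d [d0 d1 ->]] t0 t1.
exists (fun w => t * d w + (1 - t) * c w); split.
- by move=> w wT; rewrite addr_ge0 // mulr_ge0 ?c0 ?d0 ?subr_ge0.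
- by rewrite big_split /= -!mulr_sumr c1 d1 !mulr1 addrC subrK.
- rewrite !scaler_sumr -big_split /=; apply: eq_bigr => w _.
  by rewrite [RHS]scalerDl !scalerA.
Qed.

Lemma hull_star T v x t : v \in T -> hull T x -> 0 <= t -> t <= 1 ->
  hull T (t *: (x - v) + v).
Proof.
move=> vT Tx t0 t1.
have -> : t *: (x - v) + v = t *: x + (1 - t) *: v.
  by rewrite scalerBr scalerBl scale1r -addrA; congr (_ + _); rewrite addrC.
exact: hull_convex (hull_vertex vT) Tx t0 t1.
Qed.

Lemma ball_convex x d y z t : ball x d y -> ball x d z -> 0 <= t -> t <= 1 ->
  ball x d (t *: z + (1 - t) *: y).
Proof.
rewrite -!ball_normE /ball_ /= => yd zd t0 t1.
have -> : x - (t *: z + (1 - t) *: y) = t *: (x - z) + (1 - t) *: (x - y).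
  rewrite !scalerBr addrACA -scalerDl [t + _]addrC subrK scale1r.
  by rewrite -opprD.
apply: le_lt_trans (ler_normD _ _) _; rewrite !normrZ.
rewrite ger0_norm // (@ger0_norm _ (1 - t)) ?subr_ge0 //.
have [->|tn0] := eqVneq t 0; first by rewrite mul0r add0r subr0 mul1r.
have tp : 0 < t by rewrite lt0r tn0.
have H1 : t * `|x - z| < t * d by rewrite ltr_pM2l.
have H2 : (1 - t) * `|x - y| <= (1 - t) * d by rewrite ler_wpM2l ?subr_ge0 ?(ltW yd).
apply: lt_le_trans (ltr_leD H1 H2) _.
by rewrite -mulrDl addrC subrK mul1r.
Qed.

Lemma near_simplices K x : (forall T, T \in K -> is_simplex n T) ->
  \forall y \near x, forall T, T \in K -> hull T y -> hull T x.
Proof.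
move=> sK; have : nbhs x (\bigcap_(T in [set` K]) [set y | hull T y -> hull T x]).
  apply: filter_bigI => T TK.
  have [Tx|nTx] := pselect (hull T x); first by apply: filterS filterT => y _ _.
  have : \forall y \near x, ~ hull T y.
    by apply: open_nbhs_nbhs; split=> //; apply: closed_openC; apply/hull_closed/sK.
  by apply: filterS => y nTy /nTy.
by apply: filterS => y H T TK; exact: (H T TK).
Qed.

Definition facet_hereditary (K : {fset {fset V}}) x (P : {fset V} -> Prop) :=
  forall T T', T \in K -> T' \in K -> common_face n.-1 T T' ->
    hull T x -> hull T' x -> P T -> P T'.

Lemma cell_simplex Delta v T : is_mesh Delta -> T \in cell Delta v ->
  is_simplex n T.
Proof. by move=> [sD _]; rewrite !inE => /andP[/sD]. Qed.

Lemma cell_vertex (Delta : {fset {fset V}}) v T : T \in cell Delta v -> v \in T.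
Proof. by rewrite !inE => /andP[]. Qed.

Lemma cell_common_face (Delta : {fset {fset V}}) v T T' : is_mesh Delta ->
  T \in cell Delta v -> T' \in cell Delta v -> T <> T' ->
  exists2 k, (k < n)%N & common_face k T T'.
Proof.
move=> [_ mD]; rewrite !inE => /andP[TD vT] /andP[TD' vT'] /(mD _ _ TD TD')[|//].
have : (hull T `&` hull T') v by split; exact: hull_vertex.
by move=> + E; rewrite E.
Qed.

(** The simplices around an interior point x are connected through common facets
    containing x.  Otherwise the simplices containing x split into two families
    such that members of different families meet in a face of dimension at most
    n - 2.  These finitely many faces have codimension at least 2, so a segment
    near x between generic points y1 and y2 of two simplices, one of each
    family, avoids them all.  The unions of the two families then cut this
    segment into two disjoint nonempty closed pieces, against its
    connectedness. *)
Lemma facet_connectivity (Delta : {fset {fset V}}) v x P T1 T2 :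
  is_mesh Delta -> (Omega (cell Delta v))° x ->
  facet_hereditary (cell Delta v) x P ->
  T1 \in cell Delta v -> T2 \in cell Delta v -> hull T1 x -> hull T2 x ->
  P T1 -> P T2.
Proof.
move=> mD Ox HP T1K T2K T1x T2x P1; apply: contrapT => NP2.
set K := cell Delta v in Ox HP T1K T2K.
have sK T : T \in K -> is_simplex n T by exact: cell_simplex.
have : \forall y \near x, Omega K y /\ forall T, T \in K -> hull T y -> hull T x.
  by apply: filterI; [exact: Ox | exact: near_simplices].
move=> /nbhs_ballP[d /= d0 Hd].
have openpart T : T \in K -> hull T x ->
    exists2 C : set V, open C & C !=set0 /\ C `<=` hull T `&` ball x d.
  move=> TK Tx; have [C oC [[c Cc] sC star]] := hull_interior (sK T TK).
  exists (C `&` ball x d); first by apply: openI => //; exact: ball_open.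
  split; last by move=> y [/sC].
  pose M := `|c - x| + 1; have M0 : 0 < M by rewrite ltr_wpDl.
  pose t := Order.min 1 (d / 2 / M).
  have t0 : 0 < t by rewrite lt_min ltr01 !divr_gt0.
  have t1 : t <= 1 by rewrite ge_min lexx.
  exists (t *: c + (1 - t) *: x); split; first exact: star.
  rewrite -ball_normE /ball_ /= scalerBl scale1r addrCA -scalerBr opprD addrA.
  rewrite subrr add0r normrN normrZ gtr0_norm //.
  apply: le_lt_trans (_ : d / 2 / M * M < d); last first.
    by rewrite divfK ?gt_eqF // ltr_pdivrMr // mulr_natr mulr2n ltrDl.
  apply: ler_pM; rewrite ?(ltW t0) //; first by rewrite /t ge_min lexx orbT.
  by rewrite /M lerDl.
have [C1 oC1 [C10 sC1]] := openpart T1 T1K T1x.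
have [C2 oC2 [C20 sC2]] := openpart T2 T2K T2x.
pose faces : seq {fset V} := flatten [seq enum_fset (fpowerset T) | T <- K].
have facesP T W : T \in K -> (W `<=` T)%fset -> W \in faces.
  move=> TK WT; apply/flattenP; exists (enum_fset (fpowerset T)).
    by apply/mapP; exists T.
  by rewrite -[W \in _]/(W \in fpowerset T) fpowersetE.
(* y1 off hyperplanes containing the low-dimensional faces W; y2 off
   hyperplanes containing W and y1: then the line through y1 and y2 misses W *)
have [a1 Ha1] : {a : {fset V} -> 'rV[R]_(1 + n) & forall W, a W != 0 /\
    ((#|` W| <= n)%N -> forall w, w \in W -> aff (a W) w = 0)}.
  apply: (choice (P := fun (W : {fset V}) (a : 'rV[R]_(1 + n)) => a != 0 /\
    ((#|` W| <= n)%N -> forall w, w \in W -> aff a w = 0))) => W.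
  have [Wn|Wn] := leqP #|` W| n.
    by have [a a0 Ha] := hyperplane_through Wn; exists a.
  (* large faces impose no condition: any nonzero coefficient vector will do *)
  have [a a0 _] := @hyperplane_through R n [::] (leq0n n).
  by exists a.
have [y1 Cy1 Hy1] := generic_point faces oC1 C10 (fun W => (Ha1 W).1).
have [a2 Ha2] : {a : {fset V} -> 'rV[R]_(1 + n) & forall W, a W != 0 /\
    ((#|` W| < n)%N -> aff (a W) y1 = 0 /\ forall w, w \in W -> aff (a W) w = 0)}.
  apply: (choice (P := fun (W : {fset V}) (a : 'rV[R]_(1 + n)) => a != 0 /\
    ((#|` W| < n)%N -> aff a y1 = 0 /\ forall w, w \in W -> aff a w = 0))) => W.
  have [Wn|Wn] := ltnP #|` W| n.
    have [a a0 Ha] := @hyperplane_through R n (y1 :: W) Wn.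
    exists a; split=> // _; split=> [|w wW]; apply: Ha; first exact: mem_head.
    by rewrite in_cons wW orbT.
  have [a a0 _] := @hyperplane_through R n [::] (leq0n n).
  by exists a.
have [y2 Cy2 Hy2] := generic_point faces oC2 C20 (fun W => (Ha2 W).1).
have [T1y1 By1] := sC1 _ Cy1; have [T2y2 By2] := sC2 _ Cy2.
pose gamma (s : R) : V := s *: y2 + (1 - s) *: y1.
have cgamma : continuous gamma.
  move=> s; apply: cvgD; apply: cvgZr_tmp; first exact: cvg_id.
  by apply: cvgB; [exact: cvg_cst | exact: cvg_id].
have avoid (W : {fset V}) s : W \in faces -> (#|` W| < n)%N -> ~ hull W (gamma s).
  move=> Wf Wn Ws; have [a20 /(_ Wn)[a2y1 a2W]] := Ha2 W.
  have [a10 /(_ (ltnW Wn)) a1W] := Ha1 W.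
  have : aff (a2 W) (gamma s) = 0 by exact: hull_aff0 Ws.
  rewrite aff_segment a2y1 mulr0 addr0 => /eqP.
  rewrite mulf_eq0 (negbTE (Hy2 W Wf)) orbF => /eqP s0.
  have /eqP := hull_aff0 a1W Ws.
  by rewrite /gamma s0 scale0r add0r subr0 scale1r (negbTE (Hy1 W Wf)).
pose side (Q : {fset V} -> Prop) : set R :=
  [set s | exists T, [/\ T \in K, Q T & hull T (gamma s)]].
have side_closed Q : closed (side Q).
  have -> : side Q = gamma @^-1`
      (\bigcup_(T in [set T | T \in K /\ Q T]) hull T).
    apply/seteqP; split=> s.
      by move=> [T [TK QT Ts]]; exists T.
    by move=> [T [TK QT] Ts]; exists T.
  apply: preimage_closed => [s _|]; first exact: cgamma.
  apply: closed_bigcup => [|T [TK _]]; last by apply/hull_closed/sK.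
  by apply: sub_finite_set (finite_fset K) => T [].
have seg s : s \in `[0, 1] -> Omega K (gamma s) /\
    forall T, T \in K -> hull T (gamma s) -> hull T x.
  by rewrite in_itv /= => /andP[s0 s1]; apply: Hd; exact: ball_convex.
have cover s : s \in `[0, 1] -> side P s \/ side (fun T => ~ P T) s.
  move=> /seg[[T /= TK Ts] _].
  by have [PT|NPT] := pselect (P T); [left|right]; exists T.
have disj s : s \in `[0, 1] -> side P s -> side (fun T => ~ P T) s -> False.
  move=> /seg[_ near_x] [T [TK PT Ts]] [T' [T'K NPT' T's]].
  have TT' : T <> T' by move=> E; apply: NPT'; rewrite -E.
  have [k kn cf] := cell_common_face mD TK T'K TT'.
  have [kE|kE] := eqVneq k n.-1.
    apply: NPT'; apply: (HP T) => //; [by rewrite -kE|exact: near_x|exact: near_x].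
  have [[W [WT Wk TW]] _] := cf.
  apply: (avoid W s); first exact: facesP WT.
    by rewrite Wk ltn_neqAle kn andbT; apply: contra_neq kE => <-.
  by rewrite -TW.
have E : `[0, 1]%classic `&` side P = `[0, 1]%classic.
  apply: (@segment_connected R 0 1).
  - exists 0; split; first by rewrite /= in_itv /= lexx ler01.
    by exists T1; split=> //; rewrite /gamma scale0r add0r subr0 scale1r.
  - exists (~` side (fun T => ~ P T)); first exact: closed_openC.
    apply/seteqP; split=> s [s01 Ps]; split=> //; first by move=> /(disj s s01 Ps).
    by have [|/Ps] := cover s s01.
  - by exists (side P).
have [] : (`[0, 1]%classic `&` side P) 1 by rewrite E /= in_itv /= lexx ler01.
move=> s1 PS1; apply: (disj 1) => //.
by exists T2; split=> //; rewrite /gamma scale1r subrr scale0r addr0.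
Qed.

End Simplices.

(** * Gluing polynomial pieces *)

Section Gluing.
Context {R : realType} {n : nat}.
Local Notation V := 'rV[R]_n.
Local Notation e_ i := (delta_mx ord0 i : V).
Local Notation mder := (@mderiv n R).
Implicit Types (u v w x y : V) (T W : {fset V}) (K : {fset {fset V}}).

Lemma near_fset_all (K : {fset {fset V}}) (X : Type) (F : set_system X)
    (Q : {fset V} -> X -> Prop) : Filter F ->
  (forall T, T \in K -> \forall y \near F, Q T y) ->
  \forall y \near F, forall T, T \in K -> Q T y.
Proof.
move=> FF H; have := filter_bigI FF H.
by apply: filterS => y Hy T TK; exact: Hy.
Qed.

(** Polynomial pieces whose derivatives of order at most r agree on the
    intersections of simplices glue to a C^r function.  To differentiate at an
    interior point x along a coordinate, note that every simplex containing a
    point y near x also contains x; so the difference quotient between x and y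
    is that of a single polynomial piece, and there are finitely many pieces
    to bound at once. *)
Lemma glue_Ck_closed K (p : {fset V} -> mpoly n R) (s : V -> R) (r : nat) :
  (forall T, T \in K -> is_simplex n T) ->
  (forall T x, T \in K -> hull T x -> s x = peval (p T) x) ->
  (forall T T' x l, T \in K -> T' \in K -> hull T x -> hull T' x ->
     (size l <= r)%N -> peval (foldr mder (p T) l) x = peval (foldr mder (p T') l) x) ->
  Ck_closed r (Omega K) s.
Proof.
move=> sK sp pp.
have [tau Htau] : {tau : V -> {fset V} & forall x, Omega K x ->
    tau x \in K /\ hull (tau x) x}.
  apply: (choice (P := fun x T => Omega K x -> T \in K /\ hull T x)) => x.
  have [[T TK Tx]|NO] := pselect (Omega K x); first by exists T.
  by exists fset0.
pose q T l := foldr mder (p T) l.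
(* G l is the would-be derivative of s of index list l, read on any simplex *)
have [G GE] : exists G : seq 'I_n -> V -> R, forall l T x,
    T \in K -> hull T x -> (size l <= r)%N -> G l x = peval (q T l) x.
  exists (fun l x => peval (q (tau x) l) x) => l T x TK Tx lr.
  have Ox : Omega K x by exists T.
  by have [tK tx] := Htau x Ox; apply: pp.
have G0 x : Omega K x -> s x = G [::] x.
  by move=> [T TK Tx]; rewrite (GE [::] T) // (sp T).
have Gcont l : (size l <= r)%N -> {within Omega K, continuous (G l)}.
  move=> lr; apply/subspace_continuousP => x Ox; apply/cvgrPdist_le => e e0.
  have H1 := near_simplices x sK.
  have H2 : \forall y \near x, forall T, T \in K ->
      `|peval (q T l) x - peval (q T l) y| <= e.
    apply: (@near_fset_all K V (nbhs x)
      (fun T y => `|peval (q T l) x - peval (q T l) y| <= e)) => T TK.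
    have [c _] := peval_smooth1 (q T l).
    by move/cvgrPdist_le : (c x); apply.
  apply: filterS2 H1 H2 => y {}H1 {}H2 Oy; rewrite /from_subspace /=.
  have [tK ty] := Htau y Oy.
  rewrite (GE l (tau y) x) //; last exact: H1 ty.
  by rewrite (GE l (tau y) y) //; exact: H2.
have Gder l i x : (size l < r)%N -> (Omega K)° x ->
    is_derive x (e_ i) (G l) (G (i :: l) x).
  move=> lr Ox; have Ox' := interior_subset Ox.
  suff cv : h^-1 *: ((G l \o shift x) (h *: e_ i) - G l x) @[h --> 0^'] -->
      (G (i :: l) x : R^o).
    by split; [apply/cvg_ex; eexists; exact: cv | exact: cvg_lim].
  apply/cvgrPdist_le => e e0.
  have cl : h *: e_ i + x @[h --> (0 : R)^'] --> x.
    suff : h *: e_ i + x @[h --> (0 : R)^'] --> (0 : R) *: e_ i + x by rewrite scale0r add0r.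
    apply: cvg_within_filter; apply: cvgD; last exact: cvg_cst.
    by apply: cvgZr_tmp; exact: cvg_id.
  have H1 : \forall h \near (0 : R)^', forall T, T \in K ->
      hull T (h *: e_ i + x) -> hull T x by exact: cl _ (near_simplices x sK).
  have H2 : \forall h \near (0 : R)^', Omega K (h *: e_ i + x) by exact: cl _ Ox.
  have H3 : \forall h \near (0 : R)^', forall T, T \in K ->
      `|peval (mder i (q T l)) x -
        h^-1 *: ((peval (q T l) \o shift x) (h *: e_ i) - peval (q T l) x)| <= e.
    apply: (@near_fset_all K R (0 : R)^'
      (fun T h => `|peval (mder i (q T l)) x - h^-1 *:
        ((peval (q T l) \o shift x) (h *: e_ i) - peval (q T l) x)| <= e)) => T TK.
    have [_ /(_ x i)[dq Eq]] := peval_smooth1 (q T l).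
    rewrite -Eq; move/cvgrPdist_le : dq; exact.
  apply: filterS3 H1 H2 H3 => h {}H1 {}H2 {}H3.
  have [tK ty] := Htau _ H2.
  have tx := H1 _ tK ty.
  rewrite /= (GE (i :: l) (tau (h *: e_ i + x)) x) //.
  rewrite (GE l (tau (h *: e_ i + x)) x) // ?(ltnW lr) //.
  rewrite (GE l (tau (h *: e_ i + x)) (h *: e_ i + x)) // ?(ltnW lr) //.
  exact: H3.
have Gpart l x : (size l <= r)%N -> (Omega K)° x -> partials l s x = G l x.
  elim: l x => [|i l IH] x lr Ox /=; first by apply: (G0 x); exact: interior_subset Ox.
  have [_ <-] := Gder l i x lr Ox.
  apply: near_eq_derive; near=> y; apply: IH; first exact: ltnW.
  by near: y; apply: open_nbhs_nbhs; split=> //; exact: open_interior.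
have Gnear l x : (size l <= r)%N -> (Omega K)° x -> \near x, G l x = partials l s x.
  move=> lr Ox; near=> y; rewrite Gpart //.
  by near: y; apply: open_nbhs_nbhs; split=> //; exact: open_interior.
split.
- apply: (subspace_eq_continuous (f := G [::])); last exact: Gcont.
  by move=> x /set_mem Ox; exact: (esym (G0 x Ox)).
- split=> [l i x lr Ox|l x lr Ox].
    apply: near_eq_derivable (Gnear l x (ltnW lr) Ox) _.
    by have [d _] := Gder l i x lr Ox; exact: d.
  apply: near_eq_continuous (Gnear l x lr Ox) _.
  have /subspace_continuousP/(_ x (interior_subset Ox)) := Gcont l lr.
  by rewrite within_interior.
- move=> a ar; exists (G (seq_of_multi a)).
    by apply: Gcont; rewrite size_seq_of_multi.
  by move=> x Ox; rewrite multi_partialE Gpart // size_seq_of_multi.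
Unshelve. all: by end_near. Qed.

(** The continuous extension g of a derivative of s agrees with that of the piece
    p on the open simplex, hence on the closed simplex, which is in its
    closure.  So the derivatives of two pieces agree where they meet. *)
Lemma derivative_trace K T (p : mpoly n R) (s : V -> R) :
  is_simplex n T -> T \in K ->
  (forall x, hull T x -> s x = peval p x) ->
  forall (a : multinom n) (g : V -> R),
    {within Omega K, continuous g} ->
    (forall x, (Omega K)° x -> g x = multi_partial a s x) ->
    forall x, hull T x -> g x = multi_partial a (peval p) x.
Proof.
move=> sT TK sp a g cg Eg x Tx.
have [C oC [[c Cc] sC star]] := hull_interior sT.
have TO : hull T `<=` Omega K by move=> y Ty; exists T.
have CO : C `<=` (Omega K)°.
  move=> y Cy; have : nbhs y C by apply: open_nbhs_nbhs; split.
  by apply: filterS => z /sC /TO.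
have EC y : C y -> g y = multi_partial a (peval p) y.
  move=> Cy; rewrite Eg; last exact: CO.
  by apply: (near_eq_partials _ oC Cy) => z Cz; apply: sp; exact: sC.
pose gam (t : R) : V := t *: c + (1 - t) *: x.
have cgam : gam t @[t --> 0^'+] --> x.
  suff : gam t @[t --> 0^'+] --> gam 0 by rewrite /gam scale0r add0r subr0 scale1r.
  apply: cvg_at_right_filter.
  apply: cvgD; apply: cvgZr_tmp; first exact: cvg_id.
  by apply: cvgB; [exact: cvg_cst | exact: cvg_id].
have gamC : \forall t \near (0 : R)^'+, C (gam t).
  have t01 : \forall t \near (0 : R)^'+, 0 < t /\ t <= 1.
    by apply: filterI; [exact: nbhs_right_gt | exact: nbhs_right_le].
  by apply: filterS t01 => t [t0 t1]; exact: star.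
have c1 : g (gam t) @[t --> 0^'+] --> g x.
  have /subspace_continuousP/(_ x (TO _ Tx)) gx := cg.
  apply: cvg_comp gx => A /= wA.
  have := cgam _ wA; apply: filterS2 gamC => t Ct /= H.
  by apply: H; apply/TO/sC.
have c2 : g (gam t) @[t --> 0^'+] --> multi_partial a (peval p) x.
  have c3 : multi_partial a (peval p) (gam t) @[t --> 0^'+] -->
      multi_partial a (peval p) x.
    apply: cvg_comp cgam _; rewrite multi_partial_peval.
    by have [c' _] := peval_smooth1 (mderivm a p); exact: c'.
  apply: cvg_trans c3; apply: near_eq_cvg.
  by apply: filterS gamC => t /EC ->.
exact: cvg_unique c1 c2.
Qed.

End Gluing.

(** * Supersmoothness and degenerate spaces *)

Section Cells.
Context {R : realType} {n : nat}.
Local Notation V := 'rV[R]_n.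
Local Notation mder := (@mderiv n R).
Implicit Types (u v w x y : V) (T W : {fset V}) (K Delta : {fset {fset V}}).

Lemma polys_sub_poly_splines r d K : (forall T, T \in K -> is_simplex n T) ->
  polys_on d (Omega K) `<=` poly_splines r d K.
Proof.
move=> sK s [p pd sp]; have TO T x : T \in K -> hull T x -> Omega K x.
  by move=> TK Tx; exists T.
split; last by move=> T TK; exists p => // x /(TO T x TK); exact: sp.
apply: (@glue_Ck_closed R n K (fun=> p)) => // T x TK Tx.
by apply: sp; exact: TO Tx.
Qed.

(** The pieces of a C^r piecewise polynomial form a spline of [smooth_splines r];
    their d-jets at v agree by hypothesis, which determines polynomials of
    degree at most d. *)
Lemma splines_at_degenerate Delta v r d : is_mesh Delta -> is_vertex Delta v ->
  smooth_splines r (cell Delta v) `<=` splines_at d (cell Delta v) v ->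
  degenerate r d (cell Delta v).
Proof.
move=> mD [T0 T0D vT0] Hsub.
set K := cell Delta v in Hsub *.
have sK T : T \in K -> is_simplex n T by exact: cell_simplex.
have T0K : T0 \in K by rewrite !inE T0D.
apply/seteqP; split; last exact: polys_sub_poly_splines.
move=> s [Cs ps].
have [p Hp] : {p : {fset V} -> mpoly n R & forall T, T \in K ->
    (msize (p T) <= d.+1)%N /\ forall x, hull T x -> s x = peval (p T) x}.
  apply: (choice (P := fun T (q : mpoly n R) => T \in K -> (msize q <= d.+1)%N /\
    forall x, hull T x -> s x = peval q x)) => T.
  have [TK|NTK] := boolP (T \in K); last by exists 0.
  by have [q qd sq] := ps T TK; exists q.
pose sigma T : set V * (V -> R) := (setT, peval (p T)).
have Ssigma : splines K sigma.
  by move=> T TK; split => //; [exact: openT | exact: smooth_peval].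
have : smooth_splines r K sigma.
  split=> // a T1 T2 ar T1K T2K _ x [T1x T2x] /=.
  have [_ _ /(_ a ar)[g cg Eg]] := Cs.
  have tr T : T \in K -> hull T x -> g x = multi_partial a (peval (p T)) x.
    move=> TK Tx; exact: (derivative_trace (sK T TK) TK (Hp T TK).2 cg).
  by rewrite -(tr T1) // -(tr T2).
move=> /Hsub[_ Hv].
have pT0 T : T \in K -> p T = p T0.
  move=> TK; apply: (@jet_poly_eq _ _ d _ _ v); [exact: (Hp T TK).1|exact: (Hp T0 T0K).1|].
  by move=> a ad; exact: (Hv a T T0 ad TK T0K).
exists (p T0); first exact: (Hp T0 T0K).1.
by move=> x [T /= TK Tx]; rewrite -(pT0 T TK); exact: (Hp T TK).2.
Qed.

Lemma smooth_splines_at_order Delta v r : is_mesh Delta -> interior_cell Delta v ->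
  smooth_splines r (cell Delta v) `<=` splines_at r (cell Delta v) v.
Proof.
move=> mD iv sigma [Ss Hs]; split=> // a T1 T2 ar T1K T2K.
have vh T : T \in cell Delta v -> hull T v.
  by move=> TK; apply: hull_vertex; exact: cell_vertex TK.
apply: (@facet_connectivity _ _ Delta v v (fun T =>
  multi_partial a (sigma T1).2 v = multi_partial a (sigma T).2 v) T1 T2) => //.
- move=> T T' TK T'K cf Tv T'v ->; exact: (Hs a T T' ar TK T'K cf).
- exact: vh.
- exact: vh.
Qed.

(** For x on the common facet, the segment from v to x stays on the facet, where
    the difference of the derivatives of the two functions vanishes;
    [taylor_vanish_ray] passes this on to the Taylor polynomials. *)
Lemma taylor_facet_match K v r d (sigma : spline_family) (p : {fset V} -> mpoly n R) T T' :
  smooth_splines r K sigma ->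
  (forall T, T \in K -> (msize (p T) <= d.+1)%N /\ forall a, (mdeg a <= d)%N ->
     multi_partial a (peval (p T)) v = multi_partial a (sigma T).2 v) ->
  T \in K -> T' \in K -> v \in T -> v \in T' -> common_face n.-1 T T' ->
  (r <= d)%N -> forall l x, (size l <= r)%N -> hull T x -> hull T' x ->
  peval (foldr mder (p T - p T') l) x = 0.
Proof.
move=> [Ss Hs] Hp TK T'K vT vT' cf rd l x lr Tx T'x.
have [oU sU fU] := Ss T TK; have [oU' sU' fU'] := Ss T' T'K.
set U := (sigma T).1 in oU sU fU; set U' := (sigma T').1 in oU' sU' fU'.
set f := (sigma T).2 in fU; set f' := (sigma T').2 in fU'.
have oI : open (U `&` U') by exact: openI.
have sg : smooth_open (U `&` U') (partials l f).
  by apply: smooth_partials; apply: smooth_subset fU => z [].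
have sg' : smooth_open (U `&` U') (partials l f').
  by apply: smooth_partials; apply: smooth_subset fU' => z [].
have sg'N := smoothZ (-1) oI sg'.
have vU : U v by apply: sU; exact: hull_vertex.
have vU' : U' v by apply: sU'; exact: hull_vertex.
have jet l' : (size l' <= d)%N -> forall T0 U0, T0 \in K -> open U0 -> U0 v ->
    smooth_open U0 (sigma T0).2 ->
    partials l' (sigma T0).2 v = peval (foldr mder (p T0) l') v.
  move=> ld T0 U0 T0K oU0 Uv0 sm0; rewrite -partials_peval.
  apply: (eq_multi_partials oU0 sm0 Uv0 openT (@smooth_peval R n setT _) I) => a al.
  by rewrite (Hp T0 T0K).2 // al.
have msz : (msize (foldr mder (p T - p T')%R l) <= (d - size l).+1)%N.
  apply: msize_foldr_mderiv; apply: leq_trans (msizeD_le _ _) _.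
  rewrite msizeN geq_max addSn subnK; last exact: leq_trans rd.
  by rewrite (Hp T TK).1 (Hp T' T'K).1.
have := @taylor_vanish_ray R n (U `&` U') (partials l f \+ (-1 \*: partials l f'))
  (foldr mder (p T - p T') l) v (x - v) (d - size l)%N 1 oI _ _ msz.
have -> : peval (foldr mder (p T - p T') l) x =
    peval (foldr mder (p T - p T') l) (1 *: (x - v) + v).
  by rewrite scale1r subrK.
apply => //.
- exact: smoothD.
- move=> l' l'd; rewrite (partialsD l' oI sg sg'N) // (partialsZ _ l' oI sg') //.
  rewrite -!partials_cat mulN1r partials_peval -foldr_cat foldr_mderivB pevalB.
  have sz : (size (l' ++ l) <= d)%N.
    by rewrite size_cat -(subnK (leq_trans lr rd)) leq_add2r.
  by rewrite (jet _ sz T U) // (jet _ sz T' U').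
- move=> t t0 t1.
  have Tt : hull T (t *: (x - v) + v) by apply: hull_star => //; exact: ltW.
  have T't : hull T' (t *: (x - v) + v) by apply: hull_star => //; exact: ltW.
  split; first by split; [exact: sU | exact: sU'].
  rewrite /= [X in X + _](_ : _ = partials l f' (t *: (x - v) + v)).
    by rewrite -[-1 *: _]/(-1 * _) mulN1r subrr.
  apply: (eq_multi_partials oU fU _ oU' fU' _) => [||a al]; [exact: sU|exact: sU'|].
  by apply: (Hs a T T' _ TK T'K cf); rewrite ?al.
Qed.

(** The Taylor polynomials of degree d at v of a spline glue to an element of
    [poly_splines r d], hence are restrictions of one polynomial, and the
    spline has a single d-jet at v. *)
Lemma degenerate_splines_at Delta v r d : is_mesh Delta -> interior_cell Delta v ->
  (r <= d)%N -> degenerate r d (cell Delta v) ->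
  smooth_splines r (cell Delta v) `<=` splines_at d (cell Delta v) v.
Proof.
move=> mD iv rd dg sigma Ssigma; split; first exact: Ssigma.1.
set K := cell Delta v in dg Ssigma *.
have sK T : T \in K -> is_simplex n T by exact: cell_simplex.
have vK T : T \in K -> v \in T by exact: cell_vertex.
have [p Hp] : {p : {fset V} -> mpoly n R & forall T, (msize (p T) <= d.+1)%N /\
    forall a, (mdeg a <= d)%N ->
      multi_partial a (peval (p T)) v = multi_partial a (sigma T).2 v}.
  apply: (choice (P := fun T (q : mpoly n R) => (msize q <= d.+1)%N /\
    forall a, (mdeg a <= d)%N ->
      multi_partial a (peval q) v = multi_partial a (sigma T).2 v)) => T.
  by have [q qd Hq] := taylor_interpolation (fun a => multi_partial a (sigma T).2 v) v d;
    exists q.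
have facet T T' l x : T \in K -> T' \in K -> common_face n.-1 T T' ->
    (size l <= r)%N -> hull T x -> hull T' x ->
    peval (foldr mder (p T) l) x = peval (foldr mder (p T') l) x.
  move=> TK T'K cf lr Tx T'x; apply/eqP; rewrite -subr_eq0 -pevalB -foldr_mderivB.
  apply/eqP; apply: (taylor_facet_match Ssigma (fun T _ => Hp T) TK T'K) => //.
    exact: vK.
  exact: vK.
have match_all T T' x l : T \in K -> T' \in K -> hull T x -> hull T' x ->
    (size l <= r)%N -> peval (foldr mder (p T) l) x = peval (foldr mder (p T') l) x.
  move=> TK T'K Tx T'x lr; apply/eqP; rewrite -subr_eq0 -pevalB -foldr_mderivB.
  (* x may be on the boundary of the cell, but the points of the segment [v, x]
   near v are interior, and the match extends from them along the line *)
  apply/eqP; pose q := foldr mder (p T - p T') l.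
  have cl : t *: (x - v) + v @[t --> (0 : R)] --> v.
    suff : t *: (x - v) + v @[t --> (0 : R)] --> (0 : R) *: (x - v) + v.
      by rewrite scale0r add0r.
    by apply: cvgD; [apply: cvgZr_tmp; exact: cvg_id | exact: cvg_cst].
  have : \forall t \near (0 : R), (Omega K)° (t *: (x - v) + v).
    by apply: cl; apply: open_nbhs_nbhs; split=> //; exact: open_interior.
  move=> /nbhs_ballP[e /= e0 He].
  pose e' := Order.min e 1; have e'0 : 0 < e' by rewrite lt_min e0 ltr01.
  have := @taylor_vanish_ray R n setT (peval q) q v (x - v) (msize q) e' openT.
  move=> /(_ (@smooth_peval R n setT q) I (leqnSn _)) H.
  have := H _ e'0 _ 1; rewrite scale1r subrK; apply => // t t0 te; split=> //.
  have [te1 t1] : t < e /\ t < 1 by move: te; rewrite lt_min => /andP[].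
  have Ot : (Omega K)° (t *: (x - v) + v).
    by apply: He; rewrite -ball_normE /ball_ /= sub0r normrN gtr0_norm.
  have Tt : hull T (t *: (x - v) + v).
    by apply: hull_star; [exact: vK|exact: Tx|exact: ltW|exact: ltW].
  have T't : hull T' (t *: (x - v) + v).
    by apply: hull_star; [exact: vK|exact: T'x|exact: ltW|exact: ltW].
  rewrite /q foldr_mderivB pevalB; apply/eqP; rewrite subr_eq0; apply/eqP.
  apply: (@facet_connectivity _ _ Delta v _ (fun T'' =>
    peval (foldr mder (p T) l) (t *: (x - v) + v) =
    peval (foldr mder (p T'') l) (t *: (x - v) + v)) T T' mD Ot) => //.
  by move=> T1 T2 T1K T2K cf T1x T2x ->; exact: facet.
have [s sp] : exists s : V -> R, forall T x, T \in K -> hull T x -> s x = peval (p T) x.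
  have [tau Htau] : {tau : V -> {fset V} & forall x, Omega K x ->
      tau x \in K /\ hull (tau x) x}.
    apply: (choice (P := fun x T => Omega K x -> T \in K /\ hull T x)) => x.
    have [[T TK Tx]|NO] := pselect (Omega K x); first by exists T.
    by exists fset0.
  exists (fun x => peval (p (tau x)) x) => T x TK Tx.
  have [tK tx] := Htau x (ex_intro2 _ _ T TK Tx).
  exact: (match_all _ _ x [::]).
have : poly_splines r d K s.
  split; first exact: glue_Ck_closed sp match_all.
  by move=> T TK; exists (p T); [exact: (Hp T).1 | move=> x; exact: sp].
rewrite dg => -[q qd sq] a T1 T2 ad T1K T2K.
have pq T : T \in K -> p T = q.
  move=> TK; have [C oC [C0 sC _]] := hull_interior (sK T TK).
  apply: (poly_eq_open oC C0) => x /sC Tx.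
  by rewrite -(sp T) // sq //; exists T.
by rewrite -(Hp T1).2 // -(Hp T2).2 // pq // pq.
Qed.

End Cells.

(** * Bound on the supersmoothness *)

Section Nondegeneracy.
Context {R : realType} {n : nat}.
Local Notation V := 'rV[R]_n.
Local Notation mder := (@mderiv n R).
Implicit Types (u v w x y : V) (T W : {fset V}) (K Delta : {fset {fset V}}).

Lemma mderiv_exprS (q : mpoly n R) i k :
  exists c, mderiv i (q ^+ k.+1) = q ^+ k * c.
Proof.
elim: k => [|k [c IH]]; first by exists (mderiv i q); rewrite expr1 expr0 mul1r.
exists (mderiv i q + c); rewrite exprS mderivM IH mulrDr exprS mulrA.
by congr (_ + _); exact: mulrC.
Qed.

(** Each derivative costs at most one factor q. *)
Lemma foldr_mderiv_expr (q q' : mpoly n R) l k :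
  exists c, foldr mder (q ^+ (k + size l) * q') l = q ^+ k * c.
Proof.
elim: l k => [|i l IH] k /=; first by exists q'; rewrite addn0.
rewrite addnS -addSn; have [c ->] := IH k.+1; have [b Eb] := mderiv_exprS q i k.
exists (b * c + q * mderiv i c); rewrite mderivM Eb mulrDr -mulrA; congr (_ + _).
by rewrite exprS mulrCA mulrA.
Qed.

Lemma foldr_mderiv_vanish (q q' : mpoly n R) l k x : (size l < k)%N ->
  peval q x = 0 -> peval (foldr mder (q ^+ k * q') l) x = 0.
Proof.
move=> lk qx; rewrite -(subnK lk) addnS -addSn.
have [c ->] := foldr_mderiv_expr q q' l (k - (size l).+1).+1.
rewrite /peval mevalM; rewrite exprS mevalM -[meval _ q]/(peval q x) qx.
by rewrite !mul0r.
Qed.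

Lemma barycentric_delta T (a : V -> 'rV[R]_(1 + n)) : is_simplex n T ->
  (forall x, \sum_(w <- T) aff (a w) x = 1 /\ \sum_(w <- T) aff (a w) x *: w = x) ->
  forall w w', w \in T -> w' \in T -> aff (a w) w' = (w == w')%:R.
Proof.
move=> [_ aT] Ha w w' wT w'T; have [s1 sx] := Ha w'.
apply: (affinely_independent_uniq (c := fun w => aff (a w) w')
  (d := fun w => (w == w')%:R) aT) => //.
  rewrite s1 (big_fsetD1 w') //= eqxx big_seq big1 ?addr0 // => z.
  by rewrite !inE => /andP[/negbTE ->].
rewrite sx (big_fsetD1 w') //= eqxx scale1r big_seq big1 ?addr0 // => z.
by rewrite !inE => /andP[/negbTE -> _]; rewrite scale0r.
Qed.

Lemma other_vertex T v : (1 <= n)%N -> is_simplex n T -> v \in T ->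
  exists2 w, w \in T & w != v.
Proof.
move=> n1 [cT _] vT; have : (0 < #|` (T `\ v)%fset|)%N.
  by have := cardfsD1 v T; rewrite vT cT add1n => -[<-].
by rewrite cardfs_gt0 => /fset0Pn[w]; rewrite !inE => /andP[wv wT]; exists w.
Qed.

(** A vertex is not interior to its own simplex: another barycentric coordinate
    is 0 at v and becomes negative on one side of v. *)
Lemma interior_cell_not_single Delta v T0 : (1 <= n)%N -> is_mesh Delta ->
  interior_cell Delta v -> T0 \in cell Delta v ->
  exists2 T1, T1 \in cell Delta v & T1 != T0.
Proof.
move=> n1 mD iv T0K; apply: contrapT => H.
have sT0 := cell_simplex mD T0K; have vT0 := cell_vertex T0K.
have [a Ha] := barycentric sT0; have ad := barycentric_delta sT0 Ha.
have [w wT0 wv] := other_vertex n1 sT0 vT0.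
have OT : Omega (cell Delta v) `<=` hull T0.
  move=> x [T /= TK Tx]; have [<-//|TT0] := eqVneq T T0.
  by exfalso; apply: H; exists T.
pose gam (t : R) : V := t *: w + (1 - t) *: v.
have cl : gam t @[t --> (0 : R)] --> v.
  suff : gam t @[t --> (0 : R)] --> gam 0 by rewrite /gam scale0r add0r subr0 scale1r.
  apply: cvgD; apply: cvgZr_tmp; first exact: cvg_id.
  by apply: cvgB; [exact: cvg_cst | exact: cvg_id].
have : \forall t \near (0 : R), Omega (cell Delta v) (gam t) by apply: cl; exact: iv.
move=> /nbhs_ballP[e /= e0 He].
have : hull T0 (gam (- (e / 2))).
  apply/OT/He; rewrite -ball_normE /ball_ /= sub0r opprK gtr0_norm ?divr_gt0 //.
  by rewrite ltr_pdivrMr // mulr_natr mulr2n ltrDl.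
rewrite (hull_aff_ge0 sT0 Ha) => /(_ w wT0).
rewrite /gam aff_segment !ad // eqxx (negbTE wv) mulr1 mulr0 addr0 oppr_ge0.
by rewrite leNgt divr_gt0.
Qed.

(** On one simplex T0 take the product p of the powers l_w^(r+1) of the barycentric
    coordinates of its vertices w other than v, and 0 on all others.  A facet
    of T0 containing v lies in l_w = 0 for some w <> v, so this is a spline in
    [smooth_splines r]; and p, being nonzero, has a nonzero jet at v of order
    at most its degree. *)
Lemma supersmoothness_bounded Delta v r : (1 <= n)%N -> is_mesh Delta ->
  is_vertex Delta v -> interior_cell Delta v ->
  exists N, forall d, smooth_splines r (cell Delta v) `<=` splines_at d (cell Delta v) v ->
    (d <= N)%N.
Proof.
move=> n1 mD [T0 T0D vT0] iv.
set K := cell Delta v; have T0K : T0 \in K by rewrite !inE T0D.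
have [T1 T1K T10] := interior_cell_not_single n1 mD iv T0K.
have sT0 := cell_simplex mD T0K.
have [a Ha] := barycentric sT0; have ad := barycentric_delta sT0 Ha.
pose p : mpoly n R := \prod_(w <- (T0 `\ v)%fset) aff_poly (a w) ^+ r.+1.
have p0 : p != 0.
  rewrite prodf_seq_neq0; apply/allP => w /=; rewrite !inE => /andP[_ wT0].
  rewrite expf_eq0 /=; apply/negP => /eqP E.
  have := ad w w wT0 wT0; rewrite -peval_aff_poly E peval0 eqxx => /eqP.
  by rewrite eq_sym oner_eq0.
have pvan T l x : T \in K -> common_face n.-1 T0 T -> (size l <= r)%N ->
    hull T0 x -> hull T x -> peval (foldr mder p l) x = 0.
  move=> TK [[W [WT0 cW EW]] _] lr T0x Tx.
  have Wh y : hull T0 y -> hull T y -> hull W y by rewrite -EW.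
  have vW : v \in W.
    apply/negPn/negP => vW; have : aff (a v) v = 0.
      apply: (@hull_aff0 _ _ _ W); last first.
        by apply: Wh; apply: hull_vertex => //; exact: cell_vertex TK.
      move=> w wW; rewrite ad //; last exact: (fsubsetP WT0).
      by case: eqVneq vW => // ->; rewrite wW.
    by rewrite ad // eqxx => /eqP; rewrite oner_eq0.
  have [w wT0 wW] : exists2 w, w \in T0 & w \notin W.
    apply: contrapT => H; have T0W : (T0 `<=` W)%fset.
      by apply/fsubsetP => w wT0; apply/negPn/negP => wW; apply: H; exists w.
    have := fsubset_leq_card T0W; have [cT _] := sT0.
    by rewrite cT cW prednK // ltnn.
  have wv : w != v by apply: contraNneq wW => ->.
  have -> : p = aff_poly (a w) ^+ r.+1 *
      \prod_(z <- ((T0 `\ v) `\ w)%fset) aff_poly (a z) ^+ r.+1.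
    by rewrite /p (big_fsetD1 w) // !inE wv.
  apply: foldr_mderiv_vanish => //; rewrite peval_aff_poly.
  apply: (@hull_aff0 _ _ _ W); last exact: Wh.
  move=> z zW; rewrite ad //; last exact: (fsubsetP WT0).
  by case: eqVneq wW => // ->; rewrite zW.
pose sigma T : set V * (V -> R) := (setT, peval (if T == T0 then p else 0)).
have Ssigma : smooth_splines r K sigma.
  split=> [T TK|b T T' br TK T'K cf x [Tx T'x]] /=.
    by split => //; [exact: openT | exact: smooth_peval].
  have lr : (size (seq_of_multi b) <= r)%N by rewrite size_seq_of_multi.
  rewrite !multi_partialE !partials_peval.
  case: eqVneq cf Tx => [->|TT0] cf Tx; case: eqVneq cf T'x => [->|T'T0] cf T'x //.
    by rewrite foldr_mderiv0 peval0 (pvan T').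
  rewrite foldr_mderiv0 peval0 (pvan T) //; case: cf => f1 f2.
  by split; rewrite setIC.
exists (msize p) => d Hd; rewrite leqNgt; apply/negP => pd.
have [_ Hv] := Hd _ Ssigma; move/eqP : p0; apply.
apply: (@jet_poly_eq _ _ d _ _ v).
- exact: leq_trans (ltnW pd) _.
- by rewrite mmeasure0.
- move=> b bd; have := Hv b T0 T1 bd T0K T1K.
  by rewrite /sigma /= eqxx (negbTE T10).
Qed.

End Nondegeneracy.

Lemma bounded_has_max (A : set nat) m N : A m -> (forall k, A k -> (k <= N)%N) ->
  exists M, is_max A M.
Proof.
move=> Am AN; have exA : exists k, `[< A k >] by exists m; apply/asboolP.
have bA k : `[< A k >] -> (k <= N)%N by move/asboolP; exact: AN.
have [M /asboolP AM HM] := ex_maxnP exA bA.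
by exists M; split=> // k Ak; apply: HM; apply/asboolP.
Qed.

Theorem corollary1 (R : realType) (n : nat) (n_ge1 : (1 <= n)%N)
    (Delta : {fset {fset 'rV[R]_n}}) (v : 'rV[R]_n)
    (meshD : is_mesh Delta) (vertexv : is_vertex Delta v)
    (interiorv : interior_cell Delta v) (r : nat) :
  exists m : nat,
    is_mos r (cell Delta v) v m /\
    is_max [set d | (r <= d)%N /\ degenerate r d (cell Delta v)]%classic m.
Proof.
have E : [set d | (r <= d)%N /\ degenerate r d (cell Delta v)] =
    [set d | (r <= d)%N /\
      smooth_splines r (cell Delta v) `<=` splines_at d (cell Delta v) v].
  apply/seteqP; split=> d [rd H]; split=> //.
    exact: degenerate_splines_at.
  exact: splines_at_degenerate.
rewrite E; have [N HN] := supersmoothness_bounded r n_ge1 meshD vertexv interiorv.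
have [||m Hm] := @bounded_has_max
    [set d | (r <= d)%N /\
      smooth_splines r (cell Delta v) `<=` splines_at d (cell Delta v) v] r N.
- by split=> //; exact: smooth_splines_at_order.
- by move=> k [_ /HN].
by exists m.
Qed.
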